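(* Let $(X_1,Y_1),(X_2,Y_2),\dots$ be a random sample (i.i.d. copies) of a random vector $(X,Y)$ with continuous joint distribution function $H$, marginal distribution functions $F$ and $G$, and (unique) copula $A$. Assume that $A$ allows a continuous Markov kernel $K_A$ and define $K_H(x,(-\infty,y]):=K_A(F(x),[0,G(y)])$ for $x,y\in\mathbb{R}$. Let $F_n,G_n$ be the univariate empirical distribution functions and $E_n$ the empirical copula of $(X_1,Y_1),\dots,(X_n,Y_n)$, and set $N(n):=\lfloor n^s\rfloor$ for some $s\in(0,\tfrac12)$. Then, almost surely, $$\lim_{n\to\infty}\sup_{(x,y)\in\mathbb{R}^2}\left|K_{\mathcal{B}_{N(n)}(E_n)}(F_n(x),[0,G_n(y)])-K_H(x,(-\infty,y])\right|=0.$$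
   Context: A (bivariate) copula is a distribution function on $[0,1]^2$ with uniform marginals; each copula $B$ corresponds to a doubly stochastic measure $\mu_B$ with $B(x,y)=\mu_B([0,x]\times[0,y])$. A Markov kernel of a copula $B$ is a map $K_B:[0,1]\times\mathcal{B}([0,1])\to[0,1]$, measurable in the first argument, a probability measure in the second, with $\int_{E_1}K_B(x,E_2)\,d\lambda(x)=\mu_B(E_1\times E_2)$ for all Borel $E_1,E_2\subseteq[0,1]$. A copula $A$ allows a continuous Markov kernel if it has a version $K_A$ such that $(x,y)\mapsto K_A(x,[0,y])$ is continuous on $[0,1]^2$; $K_A$ denotes this version. Bernstein approximation: $p_{N,k}(u)=\binom Nk u^k(1-u)^{N-k}$ for $k\in\{0,\dots,N\}$ and $p_{N,k}\equiv0$ otherwise; for a copula $B$, $\mathcal{B}_N(B)(x,y)=\sum_{i,j=1}^N B(\tfrac iN,\tfrac jN)p_{N,i}(x)p_{N,j}(y)$, with Markov kernel version $K_{\mathcal{B}_N(B)}(x,[0,y])=N\sum_{i,j=1}^N B(\tfrac iN,\tfrac jN)\big(p_{N-1,i-1}(x)-p_{N-1,i}(x)\big)p_{N,j}(y)$, $(x,y)\in[0,1]^2$. Empirical copula: with $H_n$ the bivariate empirical distribution function of the first $n$ observations, almost surely there is a unique subcopula $E_n'$ on $\{0,\tfrac1n,\dots,1\}^2$ with $H_n(x,y)=E_n'(F_n(x),G_n(y))$; $E_n$ is the copula extending $E_n'$ by bilinear interpolation on each square $[\tfrac{i-1}n,\tfrac in]\times[\tfrac{j-1}n,\tfrac jn]$.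 *)

(* Defs.v *)
From HB Require Import structures.
From mathcomp Require Import all_boot all_order all_algebra.
From mathcomp Require Import all_classical all_reals all_analysis.
Set Implicit Arguments. Unset Strict Implicit. Unset Printing Implicit Defensive.
Import Order.TTheory GRing.Theory Num.Theory numFieldNormedType.Exports.
Local Open Scope classical_set_scope.
Local Open Scope ring_scope.

Section Defs.
Variable R : realType.

Section Prob.
Variables (d : measure_display) (T : measurableType d) (P : probability T R).

Definition mutually_independent (Z : nat -> T -> (R * R)%type) : Prop :=
  forall (I : seq nat) (B : nat -> set (R * R)%type), uniq I ->
    (forall i, i \in I -> measurable (B i)) ->
    P (\bigcap_(i in [set i | i \in I]) (Z i @^-1` B i)) =
    (\prod_(i <- I) P (Z i @^-1` B i))%E.

Definition identically_distributed (Z : nat -> T -> (R * R)%type) : Prop :=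
  forall i (B : set (R * R)%type), measurable B ->
    P (Z i @^-1` B) = P (Z 0%N @^-1` B).

Definition iid (Z : nat -> T -> (R * R)%type) : Prop :=
  mutually_independent Z /\ identically_distributed Z.

Definition distr_fun (X : T -> R) (x : R) : R := fine (P [set w | X w <= x]).

Definition joint_distr_fun (X Y : T -> R) (x y : R) : R :=
  fine (P [set w | X w <= x /\ Y w <= y]).
End Prob.

Definition in01 (u : R) := u \in `[0, 1].

Definition is_copula (A : R -> R -> R) : Prop :=
  (forall u, in01 u -> A u 0 = 0 /\ A 0 u = 0 /\ A u 1 = u /\ A 1 u = u) /\
  (forall u1 u2 v1 v2, in01 u1 -> in01 u2 -> in01 v1 -> in01 v2 ->
     u1 <= u2 -> v1 <= v2 -> 0 <= A u2 v2 - A u2 v1 - A u1 v2 + A u1 v1).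

Definition doubly_stochastic_measure_of (A : R -> R -> R)
    (mu : {measure set (R * R)%type -> \bar R}) : Prop :=
  mu setT = 1%E /\
  forall x y, in01 x -> in01 y -> mu (`[0, x]%classic `*` `[0, y]%classic) = (A x y)%:E.

Definition markov_kernel_of (A : R -> R -> R) (k : R.-pker R ~> R) : Prop :=
  (forall x, in01 x -> k x `[0, 1]%classic = 1%E) /\
  exists mu : {measure set (R * R)%type -> \bar R},
    doubly_stochastic_measure_of A mu /\
    forall E1 E2 : set R, measurable E1 -> measurable E2 ->
      E1 `<=` `[0, 1]%classic -> E2 `<=` `[0, 1]%classic ->
      (\int[@lebesgue_measure R]_(x in E1) k x E2)%E = mu (E1 `*` E2).

Definition continuous_markov_kernel (k : R.-pker R ~> R) : Prop :=
  {within `[0, 1]%classic `*` `[0, 1]%classic,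
    continuous (fun xy : (R * R)%type => fine (k xy.1 `[0, xy.2]%classic))}.

Definition K_H (k : R.-pker R ~> R) (F G : R -> R) (x y : R) : R :=
  fine (k (F x) `[0, G y]%classic).

Section Emp.
Variable (T : Type).

Definition emp_df (X : nat -> T -> R) (n : nat) (w : T) (x : R) : R :=
  (\sum_(i < n) (((X i w <= x)%R) : nat)%:R) / n%:R.

Definition emp_joint_df (X Y : nat -> T -> R) (n : nat) (w : T) (x y : R) : R :=
  (\sum_(i < n) ((((X i w <= x)%R) && ((Y i w <= y)%R)) : nat)%:R) / n%:R.

Definition grid (n k : nat) : R := k%:R / n%:R.

Definition grid_subcopula (n : nat) (E' : R -> R -> R) : Prop :=
  (forall k, (k <= n)%N ->
     E' (grid n k) 0 = 0 /\ E' 0 (grid n k) = 0 /\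
     E' (grid n k) 1 = grid n k /\ E' 1 (grid n k) = grid n k) /\
  (forall i1 i2 j1 j2, (i1 <= i2 <= n)%N -> (j1 <= j2 <= n)%N ->
     0 <= E' (grid n i2) (grid n j2) - E' (grid n i2) (grid n j1)
          - E' (grid n i1) (grid n j2) + E' (grid n i1) (grid n j1)).

Definition is_emp_subcopula (X Y : nat -> T -> R) (n : nat) (w : T)
    (E' : R -> R -> R) : Prop :=
  grid_subcopula n E' /\
  forall x y, emp_joint_df X Y n w x y = E' (emp_df X n w x) (emp_df Y n w y).

Definition bilinear_extension (n : nat) (E' : R -> R -> R) (u v : R) : R :=
  let i := minn (Num.truncn (n%:R * u)) n.-1 in
  let j := minn (Num.truncn (n%:R * v)) n.-1 in
  let a := n%:R * u - i%:R in
  let b := n%:R * v - j%:R in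
  (1 - a) * (1 - b) * E' (grid n i) (grid n j)
  + a * (1 - b) * E' (grid n i.+1) (grid n j)
  + (1 - a) * b * E' (grid n i) (grid n j.+1)
  + a * b * E' (grid n i.+1) (grid n j.+1).

(* empirical copula E_n (the a.s. unique subcopula, chosen; extended
   bilinearly) *)
Definition emp_copula (X Y : nat -> T -> R) (n : nat) (w : T) : R -> R -> R :=
  bilinear_extension n
    (xget (fun _ _ => 0) [set E' | is_emp_subcopula X Y n w E']).
End Emp.

Definition bern (N k : nat) (u : R) : R :=
  if (k <= N)%N then 'C(N, k)%:R * u ^+ k * (1 - u) ^+ (N - k) else 0.

Definition bernstein_kernel (N : nat) (B : R -> R -> R) (x y : R) : R :=
  N%:R * \sum_(1 <= i < N.+1) \sum_(1 <= j < N.+1)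
    B (i%:R / N%:R) (j%:R / N%:R) * (bern N.-1 i.-1 x - bern N.-1 i x)
      * bern N j y.

Definition Nn (s : R) (n : nat) : nat := Num.truncn (n%:R `^ s).

End Defs.

(* Main.v *)
Require Import Defs.
From HB Require Import structures.
From mathcomp Require Import all_boot all_order all_algebra.
From mathcomp Require Import all_classical all_reals all_analysis.
From mathcomp Require Import measurable_realfun ring lra.
Import Order.TTheory GRing.Theory Num.Theory numFieldNormedType.Exports.
Local Open Scope classical_set_scope.
Local Open Scope ring_scope.
Set Implicit Arguments. Unset Strict Implicit.

(** Fix r with s < r < 1/2. Hoeffding's inequality, a union bound over an
    n x n grid of quantiles and the Borel-Cantelli lemma show that almost surely
    the empirical distribution functions are eventually within 3 n^(-r) of
    H, F and G, which forces |E_n - A| <= 27 n^(-r) on the unit square. The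
    Bernstein kernel of degree N depends on the copula in a 2N-Lipschitz way
    for the sup norm, so replacing E_n by A costs at most 54 n^(s-r). By Abel
    summation the kernel of B_N(A) is the Bernstein average of the difference
    quotients N (A((i+1)/N, j/N) - A(i/N, j/N)), which are means of K_A over
    short intervals; uniform continuity of K_A and the second moment of the
    Bernstein weights give uniform convergence to K_A. Uniform continuity also
    allows replacing F_n, G_n by F, G in the arguments of K_A. *)

(** * Empirical measures *)

(** The obstacle is the factor 2N in the stability of the Bernstein kernel: differentiating the
    polynomial amplifies an error of the copula by the degree. A qualitative Glivenko-Cantelli
    theorem is therefore not enough; the empirical copula must converge at a rate beating n^s.
    Exponential tail bounds against a union of (n+1)^2 events give every rate n^(-r) with r < 1/2,
    and the gap between s and 1/2 makes sharp constants irrelevant. A second difficulty is that E_n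
    is a chosen object: for a sample with ties the subcopula need not be unique, and without an
    existence proof the choice could be a default value. Existence is shown for every outcome by
    means of ranks, and the bound on E_n - A uses only that a subcopula is Lipschitz and reproduces
    the joint empirical distribution function at (F_n, G_n), so it covers whichever subcopula is
    chosen. Since F and G may fail to attain 0 and 1, the extreme quantiles are infinite, and points
    of the copula grid are only approximated by values of F and G. *)

Lemma expR_le_quadratic (R : realType) (x : R) :
  x <= 1 / 2 -> expR x <= 1 + x + 2 * x ^+ 2.
Proof.
move=> x2; have x1 : 0 < 1 - x by lra.
have := expR_ge1Dx (- x); rewrite expRN => h.
have e0 := expR_gt0 x.
have h1 : (1 - x) * expR x <= 1 by rewrite -ler_pdivlMr// div1r.
rewrite -(ler_pM2l x1); apply: (le_trans h1).
(* (1 - x)(1 + x + 2x^2) = 1 + x^2 (1 - 2x). *)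
have : 0 <= x ^+ 2 * (1 - 2 * x) by rewrite mulr_ge0 ?sqr_ge0//; lra.
by rewrite expr2; lra.
Qed.

(** Centring cancels the linear terms; the quadratic ones add up to 2 l^2 p (1 - p), and p (1 - p)
    <= 1/4. *)
Lemma bernoulli_mgf_le (R : realType) (p l : R) :
  0 <= p <= 1 -> 0 <= l <= 1 / 2 ->
  p * expR (l * (1 - p)) + (1 - p) * expR (l * (0 - p)) <= expR (l ^+ 2 / 2).
Proof.
move=> /andP[p0 p1] /andP[l0 l1].
have lp0 : 0 <= l * p by rewrite mulr_ge0.
have lp1 : 0 <= l * (1 - p) by rewrite mulr_ge0//; lra.
have e1 : expR (l * (1 - p)) <= 1 + l * (1 - p) + 2 * (l * (1 - p)) ^+ 2.
  by apply: expR_le_quadratic; lra.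
have e2 : expR (l * (0 - p)) <= 1 + l * (0 - p) + 2 * (l * (0 - p)) ^+ 2.
  by apply: expR_le_quadratic; lra.
have e3 := expR_ge1Dx (l ^+ 2 / 2).
apply: le_trans e3.
apply: (@le_trans _ _ (p * (1 + l * (1 - p) + 2 * (l * (1 - p)) ^+ 2)
   + (1 - p) * (1 + l * (0 - p) + 2 * (l * (0 - p)) ^+ 2))).
  by apply: lerD; apply: ler_wpM2l => //; lra.
have : 0 <= (l * (1 - 2 * p)) ^+ 2 by rewrite sqr_ge0.
rewrite !expr2; lra.
Qed.

Lemma measure_le_sum_cover d (T : measurableType d) (R : realType)
    (P : {measure set T -> \bar R}) (I : finType) (p : pred I)
    (F : I -> set T) (B : set T) :
  measurable B -> (forall i, measurable (F i)) ->
  (forall w, B w -> exists2 i, p i & F i w) ->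
  (P B <= \sum_(i | p i) P (F i))%E.
Proof.
move=> mB mF BF.
suff [mU PU] : measurable (\big[setU/set0]_(i | p i) F i) /\
    (P (\big[setU/set0]_(i | p i) F i) <= \sum_(i | p i) P (F i))%E.
  apply: le_trans PU; apply: le_measure; rewrite ?inE// => w /BF[i pi Fi].
  by rewrite (bigD1 i)//=; left.
apply: (big_rec2 (fun (U : set T) s => measurable U /\ (P U <= s)%E)).
  by rewrite measure0.
move=> i s U _ [mU PU]; split; first exact: measurableU.
by apply: (le_trans (measureU2 _ _ _)) => //; exact: leeD2l.
Qed.

Section empirical_measure.
Context {R : realType} {d : measure_display} {T : measurableType d}.
Variables (P : probability T R) (Z : nat -> T -> (R * R)%type).

Definition law (B : set (R * R)) : R := fine (P (Z 0%N @^-1` B)).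

Definition emp (n : nat) (w : T) (B : set (R * R)) : R :=
  (\sum_(i < n) (Z i w \in B)%:R) / n%:R.

Hypothesis mZ : forall i, measurable_fun setT (Z i).
Hypothesis iidZ : iid P Z.

Lemma measurable_preimage i B : measurable B -> measurable (Z i @^-1` B).
Proof. by move=> mB; rewrite -[X in measurable X]setTI; exact: mZ. Qed.

Lemma lawE B : measurable B -> P (Z 0%N @^-1` B) = (law B)%:E.
Proof.
by move=> mB; rewrite /law fineK// fin_num_measure//; exact: measurable_preimage.
Qed.

Lemma law_ge0 B : 0 <= law B.
Proof. by rewrite fine_ge0. Qed.

Lemma law_le1 B : measurable B -> law B <= 1.
Proof.
by move=> mB; rewrite -lee_fin -lawE// probability_le1//; exact: measurable_preimage.
Qed.

Lemma lawC B : measurable B -> law (~` B) = 1 - law B.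
Proof.
move=> mB; rewrite /law preimage_setC probability_setC; last exact: measurable_preimage.
by rewrite lawE.
Qed.

Lemma prob_pattern B n (f : {ffun 'I_n -> bool}) : measurable B ->
  let W := [set w | forall i : 'I_n, (Z i w \in B) = f i] in
  measurable W /\
  P W = (\prod_(i < n) (if f i then law B else 1 - law B))%:E.
Proof.
move=> mB W.
(* Independence is stated for families indexed by [nat], so [f] is extended by [false] beyond [n];
   only indices below [n] enter the intersection. *)
pose C (i : nat) := if oapp f false (insub i) then B else ~` B.
have mC i : measurable (C i).
  by rewrite /C; case: ifP => // _; exact: measurableC.
have WE : W = \bigcap_(i in [set i | i \in iota 0 n]) (Z i @^-1` C i).
  apply/seteqP; split => w /= H i.
    rewrite /= mem_iota add0n => /= in_; rewrite /C.
    rewrite (insubT (fun i => (i < n)%N) in_) /=.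
    have := H (Ordinal in_); rewrite /=; case: (f _) => [/set_mem//|/negbT].
    by rewrite notin_setE.
  have := H i; rewrite /= mem_iota add0n ltn_ord => /(_ isT).
  rewrite /C valK/=; case: (f i) => [/mem_set//|h]; apply/negbTE.
  by rewrite notin_setE.
split.
  by rewrite WE; apply: bigcap_measurableType => i _; exact: measurable_preimage.
rewrite WE iidZ.1 ?iota_uniq//.
rewrite -prodEFin.
have -> : iota 0 n = index_iota 0 n by rewrite /index_iota subn0.
rewrite big_mkord; apply: eq_bigr => i _.
rewrite iidZ.2// lawE// /C valK/=.
by case: (f i) => //; rewrite lawC.
Qed.

Lemma measurable_emp n B : measurable B -> measurable_fun setT (emp n ^~ B).
Proof.
move=> mB; apply: measurable_funM; last exact: measurable_cst.
apply: measurable_sum => i.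
rewrite (_ : (fun w => _) = \1_(Z i @^-1` B)).
  exact/measurable_indic/measurable_preimage.
by apply/funext => w; rewrite indicE; congr (_%:R); congr nat_of_bool;
  apply/idP/idP => /set_mem ?; exact/mem_set.
Qed.

Lemma measurable_emp_dev n B e : measurable B ->
  measurable [set w | e < emp n w B - law B].
Proof.
move=> mB; rewrite -[X in measurable X]setTI.
have mf : measurable_fun setT (fun w => emp n w B - law B).
  by apply: measurable_funB; [exact: measurable_emp|exact: measurable_cst].
have := mf measurableT _ (measurable_itv `]e, +oo[).
by congr (measurable (_ `&` _)); apply/seteqP; split => w /=;
  rewrite in_itv/= andbT.
Qed.

(* Summing over the 2^n possible patterns of hits replaces the expectation of
   the exponential in Chernoff's bound, so that only the product rule for
   events is needed. *)
Lemma emp_chernoff n B (e : R) : measurable B -> (0 < n)%N -> 0 <= e <= 1 ->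
  (P [set w | (e < emp n w B - law B)%R] <= (expR (- (n%:R * e ^+ 2 / 4)))%:E)%E.
Proof.
move=> mB n0 /andP[e0 e1].
pose p := law B; pose q (b : bool) : R := if b then p else 1 - p.
have p01 : 0 <= p <= 1 by rewrite law_ge0 law_le1.
have q0 b : 0 <= q b by rewrite /q; case: b => //; lra.
have n0' : 0 < n%:R :> R by rewrite ltr0n.
pose dev (f : {ffun 'I_n -> bool}) := e < (\sum_(i < n) (f i)%:R) / n%:R - p.
pose W (f : {ffun 'I_n -> bool}) := [set w | forall i : 'I_n, (Z i w \in B) = f i].
apply: (@le_trans _ _ (\sum_(f | dev f) P (W f))%E).
  apply: measure_le_sum_cover.
  - exact: measurable_emp_dev.
  - by move=> f; have [] := prob_pattern f mB.
  move=> w /= h; exists [ffun i : 'I_n => Z i w \in B]; last first.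
    by move=> i; rewrite ffunE.
  rewrite /dev; move: h; rewrite /emp.
  by under [in X in _ -> X]eq_bigr do rewrite ffunE.
have PW f : P (W f) = (\prod_(i < n) q (f i))%:E.
  by have [_ ->] := prob_pattern f mB.
under eq_bigr do rewrite PW.
rewrite sumEFin lee_fin.
(* With this tilt l^2/2 - l e = -3e^2/8, which is below -e^2/4; e <= 1 keeps l in the range of
   [bernoulli_mgf_le]. *)
pose l := e / 2.
have l0 : 0 <= l by rewrite divr_ge0.
(* On a deviating pattern the exponential factors multiply to at least 1; the other patterns only
   add nonnegative terms. The sum over all patterns then factorises into an n-th power. *)
apply: (@le_trans _ _ (\sum_(f : {ffun 'I_n -> bool})
    \prod_(i < n) (q (f i) * expR (l * ((f i)%:R - p - e))))).
  rewrite big_mkcond/=; apply: ler_sum => f _.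
  rewrite big_split/= -expR_sum; case: ifP => [devf|_]; last first.
    by rewrite mulr_ge0 ?expR_ge0// prodr_ge0.
  rewrite -[leLHS]mulr1 ler_wpM2l ?prodr_ge0//.
  rewrite -[leLHS]expR0 ler_expR -mulr_sumr mulr_ge0//.
  rewrite !sumrB !sumr_const card_ord -[p *+ n]mulr_natl -[e *+ n]mulr_natl.
  move: devf; rewrite /dev => devf.
  have := ltW devf; rewrite -(ler_pM2l n0') mulrBr mulrCA mulfV ?gt_eqF// mulr1; lra.
rewrite -(bigA_distr_bigA (fun (i : 'I_n) (b : bool) => q b * expR (l * (b%:R - p - e)))).
rewrite prodr_const card_ord.
apply: (@le_trans _ _ (expR (- (e ^+ 2 / 4)) ^+ n)); last first.
  by rewrite -expRM_natl ler_expR; lra.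
rewrite lerXn2r ?nnegrE ?expR_ge0//.
  by apply: sumr_ge0 => b _; rewrite mulr_ge0 ?expR_ge0.
rewrite big_bool/=.
have -> : p * expR (l * (1 - p - e)) + (1 - p) * expR (l * (0 - p - e)) =
    (p * expR (l * (1 - p)) + (1 - p) * expR (l * (0 - p))) * expR (- (l * e)).
  by rewrite [RHS]mulrDl -!mulrA -!expRD; congr (_ * expR _ + _ * expR _); ring.
apply: (@le_trans _ _ (expR (l ^+ 2 / 2) * expR (- (l * e)))).
  by rewrite ler_wpM2r ?expR_ge0// bernoulli_mgf_le// l0 /l; lra.
by rewrite -expRD ler_expR /l; have := sqr_ge0 e; rewrite !expr2; lra.
Qed.

Lemma empC n w B : (0 < n)%N -> emp n w (~` B) = 1 - emp n w B.
Proof.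
move=> n0; rewrite /emp.
have n0' : n%:R != 0 :> R by rewrite pnatr_eq0 -lt0n.
rewrite -[X in X - _](mulfV n0') -mulrBl; congr (_ / _).
rewrite -[X in X%:R - _](card_ord n) -sumr_const -sumrB; apply: eq_bigr => i _.
by rewrite in_setC; case: (_ \in B); rewrite /= ?subrr ?subr0.
Qed.

(** A lower deviation on B is an upper deviation on its complement, so the one-sided bound
    suffices. *)
Lemma emp_absdevE n B (e : R) : measurable B -> (0 < n)%N ->
  [set w | e < `|emp n w B - law B|] =
  [set w | e < emp n w B - law B] `|` [set w | e < emp n w (~` B) - law (~` B)].
Proof.
move=> mB n0.
have cE w : - (emp n w B - law B) = emp n w (~` B) - law (~` B).
  by rewrite empC// lawC//; ring.
by apply/seteqP; split => w /=; rewrite -cE ltr_normr => /orP.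
Qed.

Lemma emp_hoeffding n B (e : R) : measurable B -> (0 < n)%N -> 0 <= e <= 1 ->
  (P [set w | (e < `|emp n w B - law B|)%R]
     <= (2 * expR (- (n%:R * e ^+ 2 / 4)))%:E)%E.
Proof.
move=> mB n0 e01; have mC : measurable (~` B) by exact: measurableC.
rewrite emp_absdevE//.
have [m1 m2] := (measurable_emp_dev n e mB, measurable_emp_dev n e mC).
apply: (le_trans (measureU2 _ m1 m2)).
by rewrite mulrDl !mul1r EFinD; apply: leeD; exact: emp_chernoff.
Qed.

Lemma measurable_emp_absdev n B e : (0 < n)%N -> measurable B ->
  measurable [set w | e < `|emp n w B - law B|].
Proof.
move=> n0 mB; rewrite emp_absdevE//.
by apply: measurableU; apply: measurable_emp_dev => //; exact: measurableC.
Qed.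

Lemma emp_mono n w A B : A `<=` B -> emp n w A <= emp n w B.
Proof.
move=> AB; rewrite /emp ler_wpM2r// ?invr_ge0//.
apply: ler_sum => i _; rewrite ler_nat.
by have [/set_mem/AB/mem_set ->|] := boolP (Z i w \in A).
Qed.

Lemma law_mono A B : measurable A -> measurable B -> A `<=` B -> law A <= law B.
Proof.
move=> mA mB AB; rewrite -lee_fin -!lawE//.
apply: le_measure; rewrite ?inE; [exact: measurable_preimage..|].
by move=> w; exact: AB.
Qed.

Lemma lawU_le A B : measurable A -> measurable B -> law (A `|` B) <= law A + law B.
Proof.
move=> mA mB; rewrite -lee_fin EFinD -!lawE//; last exact: measurableU.
by rewrite preimage_setU measureU2//; exact: measurable_preimage.
Qed.

Lemma lawD A B : measurable A -> measurable B -> A `<=` B ->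
  law (B `\` A) = law B - law A.
Proof.
move=> mA mB AB; apply: EFin_inj; rewrite EFinB -!lawE//; last exact: measurableD.
have -> : Z 0%N @^-1` (B `\` A) = (Z 0%N @^-1` B) `\` (Z 0%N @^-1` A) by [].
rewrite measureD; [|exact: measurable_preimage..|].
  by rewrite setIidr// => w; exact: AB.
rewrite (le_lt_trans (probability_le1 _ _)) ?ltry//; exact: measurable_preimage.
Qed.

(** Infinite coordinates put H, F and G, with their empirical versions, into one family of sets, so
    that a single union bound controls all three. *)
Definition quadrant (a b : \bar R) : set (R * R) :=
  [set z | (z.1%:E <= a)%E /\ (z.2%:E <= b)%E].

Lemma measurable_quadrant a b : measurable (quadrant a b).
Proof.
have m1 (c : \bar R) (f : R * R -> R) : measurable_fun setT f ->
    measurable [set z | ((f z)%:E <= c)%E].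
  move=> mf; have := emeasurable_fun_infty_c measurableT
    ((measurable_EFinP _ _).2 mf) c.
  by rewrite setTI.
apply: (@measurableI _ _ [set z | (z.1%:E <= a)%E] [set z | (z.2%:E <= b)%E]).
  by apply: m1; exact: measurable_fst.
by apply: m1; exact: measurable_snd.
Qed.

Lemma quadrant_sub a b a' b' : (a <= a')%E -> (b <= b')%E ->
  quadrant a b `<=` quadrant a' b'.
Proof. by move=> aa bb z [za zb]; split; [exact: le_trans aa|exact: le_trans bb]. Qed.

(** The larger quadrant minus the smaller one is covered by a vertical and a horizontal strip. *)
Lemma law_quadrant_lip a b a' b' : (a <= a')%E -> (b <= b')%E ->
  law (quadrant a' b') - law (quadrant a b) <=
  (law (quadrant a' +oo) - law (quadrant a +oo)) +
  (law (quadrant +oo b') - law (quadrant +oo b)).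
Proof.
move=> aa bb; have mq := measurable_quadrant.
rewrite -(lawD (mq a b) (mq a' b') (quadrant_sub aa bb)).
rewrite -(lawD (mq a +oo%E) (mq a' +oo%E) (quadrant_sub aa (lexx _))).
rewrite -(lawD (mq +oo%E b) (mq +oo%E b') (quadrant_sub (lexx _) bb)).
apply: le_trans (lawU_le _ _); last 2 first.
- by apply: measurableD; exact: mq.
- by apply: measurableD; exact: mq.
apply: law_mono.
- by apply: measurableD; exact: mq.
- by apply: measurableU; apply: measurableD; exact: mq.
move=> z [[/= za zb] nz]; rewrite /quadrant/= !leey.
have [z1|z1] := boolP (z.1%:E <= a)%E; last by left; split => // -[].
right; split => // -[_ /= z2]; exact: nz.
Qed.

(** If no consecutive pair brackets [a], induction gives xs i <= a for all i <= m; but then the last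
    pair does bracket [a], because xs m = +oo. *)
Lemma bracketing (xs : nat -> \bar R) m a : (0 < m)%N -> xs 0%N = -oo%E ->
  xs m = +oo%E -> exists2 i, (i < m)%N & (xs i <= a)%E /\ (a <= xs i.+1)%E.
Proof.
move=> m0 x0 xm; apply: contrapT => h.
have H i : (i <= m)%N -> (xs i <= a)%E.
  elim: i => [_|i IH im]; first by rewrite x0 leNye.
  rewrite leNgt; apply/negP => /ltW axi.
  by apply: h; exists i => //; split => //; apply: IH; exact: ltnW.
apply: h; exists m.-1; first by rewrite prednK.
by split; [apply: H; exact: leq_pred|rewrite prednK// xm leey].
Qed.

(** Both measures are monotone, so at (a, b) they lie between their values at two opposite corners
    of a grid cell. The law of the gap between these corners is at most 1/m for each of the two
    strips. *)
Lemma sup_dev_le_grid (xs ys : nat -> \bar R) m n w (e : R) : (0 < m)%N ->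
  xs 0%N = -oo%E -> xs m = +oo%E -> ys 0%N = -oo%E -> ys m = +oo%E ->
  (forall i, (i <= m)%N -> law (quadrant (xs i) +oo) = i%:R / m%:R) ->
  (forall i, (i <= m)%N -> law (quadrant +oo (ys i)) = i%:R / m%:R) ->
  (forall i j, (i <= m)%N -> (j <= m)%N ->
    `|emp n w (quadrant (xs i) (ys j)) - law (quadrant (xs i) (ys j))| <= e) ->
  forall a b, `|emp n w (quadrant a b) - law (quadrant a b)| <= e + 2 / m%:R.
Proof.
move=> m0 x0 xm y0 ym Fx Gy H a b.
have [i im [xa ax]] := bracketing a m0 x0 xm.
have [j jm [yb by_]] := bracketing b m0 y0 ym.
have mq := measurable_quadrant.
have := law_quadrant_lip (le_trans xa ax) (le_trans yb by_).
rewrite !Fx ?Gy// 1?ltnW// -!mulrBl -!natrB// !subSnn -mulrDl -natrD addn1 => lip.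
have := H _ _ im jm; have := H _ _ (ltnW im) (ltnW jm).
rewrite !ler_norml => /andP[h1 h2] /andP[h3 h4].
have e1 := emp_mono n w (quadrant_sub xa yb).
have e2 := emp_mono n w (quadrant_sub ax by_).
have l1 := law_mono (mq _ _) (mq _ _) (quadrant_sub xa yb).
have l2 := law_mono (mq _ _) (mq _ _) (quadrant_sub ax by_).
by apply/andP; split; lra.
Qed.

Lemma prob_grid_dev_le (xs ys : nat -> \bar R) n (e : R) :
  (0 < n)%N -> 0 <= e <= 1 ->
  let bad := [set w | exists ij : 'I_n.+1 * 'I_n.+1,
    e < `|emp n w (quadrant (xs ij.1) (ys ij.2))
          - law (quadrant (xs ij.1) (ys ij.2))|] in
  measurable bad /\
  (P bad <= (n.+1%:R ^+ 2 * (2 * expR (- (n%:R * e ^+ 2 / 4))))%:E)%E.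
Proof.
move=> n0 e01 bad.
pose F (ij : 'I_n.+1 * 'I_n.+1) := [set w | e <
  `|emp n w (quadrant (xs ij.1) (ys ij.2)) - law (quadrant (xs ij.1) (ys ij.2))|].
have mq := measurable_quadrant.
have mF ij : measurable (F ij) by exact: measurable_emp_absdev.
have mbad : measurable bad.
  rewrite (_ : bad = \bigcup_(ij in setT) F ij).
    by apply: fin_bigcup_measurable => // ij _; exact: mF.
  by apply/seteqP; split => w [ij] => [Fw|_ Fw]; exists ij.
split => //.
apply: (@le_trans _ _ (\sum_(ij : 'I_n.+1 * 'I_n.+1) P (F ij))%E).
  apply: measure_le_sum_cover => //.
  by move=> w [ij Fij]; exists ij.
apply: (@le_trans _ _ (\sum_(ij : 'I_n.+1 * 'I_n.+1)
   (2 * expR (- (n%:R * e ^+ 2 / 4)))%:E)%E).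
  by apply: lee_sum => ij _; exact: emp_hoeffding.
rewrite sumEFin lee_fin sumr_const card_prod card_ord.
by rewrite -[leLHS]mulr_natl natrM expr2.
Qed.

End empirical_measure.

(** * Summable tails and the almost sure rate *)

Lemma powR_expR_bound (R : realType) (a : R) : 0 < a ->
  exists2 C : R, 0 <= C & forall n, (0 < n)%N ->
    n.+1%:R ^+ 2 * (2 * expR (- (n%:R `^ a / 4))) <= C * (n%:R^-1 - n.+1%:R^-1).
Proof.
(* As a k >= 4, the bound exp y >= y^k / k! gives a decay n^(-4), enough to absorb (n+1)^2 and leave
   1/(n(n+1)). *)
move=> a0; set k := (Num.truncn (4 / a)).+1.
have ak : 4 <= a * k%:R.
  have := @truncnS_gt _ (4 / a); rewrite -/k ltr_pdivrMr// => /ltW; lra.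
(* 16 comes from 2 (n+1)^3 n <= 2 (2n)^3 n. *)
exists (16 * (k`!%:R * 4 ^+ k)); first by rewrite !mulr_ge0// exprn_ge0.
move=> n n0; have n0' : 0 < n%:R :> R by rewrite ltr0n.
have n1 : 1 <= n%:R :> R by rewrite ler1n.
set y := n%:R `^ a / 4.
have y0 : 0 <= y by rewrite divr_ge0// powR_ge0.
have yk : n%:R ^+ 4 / 4 ^+ k <= y ^+ k.
  rewrite expr_div_n ler_wpM2r ?invr_ge0 ?exprn_ge0//.
  rewrite -powR_mulrn ?ler0n// -powR_mulrn ?powR_ge0// -powRrM.
  exact: ler_powR.
have ey : n%:R ^+ 4 / (k`!%:R * 4 ^+ k) <= expR y.
  have := expR_ge1Dxn k.-1 y0; rewrite prednK// => h.
  apply: (@le_trans _ _ (y ^+ k / k`!%:R)); last by lra.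
  rewrite invfM mulrA mulrAC ler_wpM2r// invr_ge0 ler0n//.
set c := k`!%:R * 4 ^+ k in ey *.
have c0 : 0 < c by rewrite mulr_gt0// ?exprn_gt0// ltr0n fact_gt0.
have em : expR (- y) <= c / n%:R ^+ 4.
  rewrite expRN -[leRHS]invrK invf_div lef_pV2 ?posrE ?expR_gt0//.
  by rewrite divr_gt0// exprn_gt0.
apply: (@le_trans _ _ (n.+1%:R ^+ 2 * (2 * (c / n%:R ^+ 4)))).
  by rewrite !ler_wpM2l// exprn_ge0.
have -> : n.+1%:R = n%:R + 1 :> R by rewrite -natr1.
move: n1 n0'; set x : R := n%:R => x1 x0.
have -> : 16 * c * (x^-1 - (x + 1)^-1) = c * (16 / (x * (x + 1))).
  by field; lra.
have -> : (x + 1) ^+ 2 * (2 * (c / x ^+ 4)) = c * (2 * (x + 1) ^+ 2 / x ^+ 4) by ring.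
rewrite ler_wpM2l ?(ltW c0)// ler_pdivlMr; last by rewrite mulr_gt0//; lra.
rewrite mulrAC ler_pdivrMr ?exprn_gt0//.
have -> : 2 * (x + 1) ^+ 2 * (x * (x + 1)) = 2 * x * (x + 1) ^+ 3 by ring.
have -> : 16 * x ^+ 4 = 2 * x * (2 * x) ^+ 3 by ring.
rewrite ler_wpM2l//; first lra.
by rewrite lerXn2r ?nnegrE//; lra.
Qed.

(** The bounds telescope, so their partial sums are at most C. The index is shifted by one inside
    because the bound starts at n = 1. *)
Lemma borel_cantelli_near d (T : measurableType d) (R : realType)
    (P : {measure set T -> \bar R}) (F : nat -> set T) (C : R) :
  (forall n, (0 < n)%N -> measurable (F n)) -> 0 <= C ->
  (forall n, (0 < n)%N -> (P (F n) <= (C * (n%:R^-1 - n.+1%:R^-1))%:E)%E) ->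
  {ae P, forall w, \forall n \near \oo, ~ F n w}.
Proof.
move=> mF C0 PF; pose G n := F n.+1.
have mG n : measurable (G n) by exact: mF.
exists (lim_sup_set G); split.
- apply: bigcap_measurableType => k _; exact: bigcup_measurable.
- apply: lim_sup_set_cvg0 => //.
  apply: (@le_lt_trans _ _ C%:E); last exact: ltry.
  apply: lime_le; first exact: is_cvg_nneseries.
  apply: nearW => n; apply: (@le_trans _ _ (\sum_(0 <= k < n)
     (C * (k.+1%:R^-1 - k.+2%:R^-1))%:E)%E).
    by apply: lee_sum => k _; exact: PF.
  rewrite sumEFin lee_fin -mulr_sumr -[leRHS]mulr1 ler_wpM2l//.
  have -> : \sum_(0 <= k < n) (k.+1%:R^-1 - k.+2%:R^-1) = 1 - n.+1%:R^-1 :> R.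
    elim: n => [|n IH]; first by rewrite big_geq// invr1 subrr.
    by rewrite big_nat_recr//= IH; ring.
  by rewrite lerBlDr lerDl invr_ge0.
move=> w /= nw n _; apply: contrapT => h; apply: nw.
exists n.+1 => // m /= nm Fm; apply: h; exists m.-1 => /=.
  by rewrite -ltnS prednK// (leq_trans _ nm).
by rewrite /G prednK// (leq_trans _ nm).
Qed.

Section glivenko_cantelli_rate.
Context {R : realType} {d : measure_display} {T : measurableType d}.
Variables (P : probability T R) (Z : nat -> T -> (R * R)%type).
Hypothesis mZ : forall i, measurable_fun setT (Z i).
Hypothesis iidZ : iid P Z.
Local Notation law := (law P Z).
Local Notation emp := (emp Z).

(** The threshold n^(-r) makes the exponent in Hoeffding's bound n^(1 - 2r)/4, a positive power of
    n. The factor 3 is 1 for the deviation at the grid points plus 2 for the mesh, since 2/n <= 2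
    n^(-r). *)
Lemma glivenko_cantelli_rate (r : R) (xs ys : nat -> nat -> \bar R) :
  0 < r < 1 / 2 ->
  (forall m, (0 < m)%N -> [/\ xs m 0%N = -oo%E, xs m m = +oo%E &
     forall i, (i <= m)%N -> law (quadrant (xs m i) +oo) = i%:R / m%:R]) ->
  (forall m, (0 < m)%N -> [/\ ys m 0%N = -oo%E, ys m m = +oo%E &
     forall i, (i <= m)%N -> law (quadrant +oo (ys m i)) = i%:R / m%:R]) ->
  {ae P, forall w, \forall n \near \oo, forall a b,
    `|emp n w (quadrant a b) - law (quadrant a b)| <= 3 * n%:R `^ (- r)}.
Proof.
move=> /andP[r0 r1] Hx Hy.
pose e n : R := n%:R `^ (- r).
have e01 n : (0 < n)%N -> 0 <= e n <= 1.
  move=> n0; rewrite /e powR_ge0/= powRN invf_le1; last by rewrite powR_gt0 ?ltr0n.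
  by rewrite -[leLHS](powRr0 n%:R) ler_powR ?ler1n// ltW.
have en n : (0 < n)%N -> n%:R^-1 <= e n.
  move=> n0; rewrite /e powRN lef_pV2 ?posrE ?powR_gt0 ?ltr0n//.
  by apply: ler1_powR; rewrite ?ler1n//; lra.
pose F n := [set w | exists ij : 'I_n.+1 * 'I_n.+1,
    e n < `|emp n w (quadrant (xs n ij.1) (ys n ij.2))
          - law (quadrant (xs n ij.1) (ys n ij.2))|].
have a0 : 0 < 1 - 2 * r by lra.
have [C C0 HC] := powR_expR_bound a0.
have : {ae P, forall w, \forall n \near \oo, ~ F n w}.
  apply: (borel_cantelli_near (C := C)) => // n n0.
    by have [] := prob_grid_dev_le mZ iidZ (xs n) (ys n) n0 (e01 _ n0).
  have [_] := prob_grid_dev_le mZ iidZ (xs n) (ys n) n0 (e01 _ n0).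
  move=> /le_trans; apply; rewrite lee_fin.
  suff -> : n%:R * e n ^+ 2 = n%:R `^ (1 - 2 * r) by exact: HC.
  rewrite /e -powR_mulrn ?powR_ge0// -powRrM -{1}[n%:R](@powRr1 R)//.
  by rewrite -powRD; [congr (_ `^ _); lra|rewrite pnatr_eq0 -lt0n n0 implybT].
apply: filterS => w; apply: filterS2 (nbhs_infty_gt 0) => n n0 nF a b.
have [x0 xm Fx] := Hx n n0; have [y0 ym Gy] := Hy n n0.
apply: (@le_trans _ _ (e n + 2 / n%:R)).
  apply: (sup_dev_le_grid mZ n0 x0 xm y0 ym Fx Gy) => i j ni nj.
  rewrite leNgt; apply/negP => h; apply: nF.
  by exists (inord i, inord j); rewrite /= !inordK.
have := en n n0; rewrite /e; lra.
Qed.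

End glivenko_cantelli_rate.

(** * Distribution functions *)

Section distribution_function.
Context {R : realType} {d : measure_display} {T : measurableType d}.
Variables (P : probability T R) (V : T -> R).
Hypothesis mV : measurable_fun setT V.
Local Notation F := (distr_fun P V).

Lemma distr_fun_cdf : exists V' : {RV P >-> R}, F = fine \o cdf V'.
Proof.
exists (mfun_Sub (mem_set mV)); apply/funext => x; rewrite /distr_fun /cdf /=.
rewrite /distribution/= /pushforward; congr (fine (P _)).
Qed.

Lemma distr_fun_cvgy1 : F x @[x --> +oo] --> (1 : R).
Proof.
have [V' ->] := distr_fun_cdf.
exact/fine_cvg/cvg_cdfy1.
Qed.

Lemma distr_fun_cvgNy0 : F x @[x --> -oo] --> (0 : R).
Proof.
have [V' ->] := distr_fun_cdf.
exact/fine_cvg/cvg_cdfNy0.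
Qed.

Lemma measurable_sublevel (x : \bar R) : measurable [set w | ((V w)%:E <= x)%E].
Proof.
have := emeasurable_fun_infty_c measurableT ((measurable_EFinP _ _).2 mV) x.
by rewrite setTI.
Qed.

Lemma distr_fun01 x : 0 <= F x <= 1.
Proof.
have mx := measurable_sublevel x%:E.
rewrite fine_ge0//= -lee_fin fineK ?probability_le1//.
by rewrite fin_num_measure.
Qed.

Lemma distr_fun_near1 (e : R) : 0 < e -> exists x, 1 - e < F x.
Proof.
move=> e0; have /cvgrPdist_lt/(_ _ e0) := distr_fun_cvgy1.
move=> /filter_ex[x h]; exists x.
by move: h; rewrite ltr_norml => /andP[]; lra.
Qed.

Lemma distr_fun_near0 (e : R) : 0 < e -> exists x, F x < e.
Proof.
move=> e0; have /cvgrPdist_lt/(_ _ e0) := distr_fun_cvgNy0.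
move=> /filter_ex[x h]; exists x.
by move: h; rewrite ltr_norml => /andP[]; lra.
Qed.

Hypothesis cF : continuous F.

Lemma distr_fun_surj u : 0 < u < 1 -> exists x, F x = u.
Proof.
move=> /andP[u0 u1].
have [a Fa] := distr_fun_near0 u0.
have [b Fb] : exists b, 1 - (1 - u) < F b by apply: distr_fun_near1; lra.
have {}Fb : u < F b by lra.
have FI : Num.min (F a) (F b) <= u <= Num.max (F a) (F b).
  by rewrite ge_min le_max (ltW Fa) (ltW Fb) orbT.
(* The order of [a] and [b] is not known here, so the intermediate value theorem is applied on
   either interval. *)
have [ab|/ltW ba] := leP a b.
  have [|c _ <-] := IVT ab _ FI; last by exists c.
  exact: continuous_subspaceT.
have [||c _ <-] := @IVT _ F b a u ba; last by exists c.
  exact: continuous_subspaceT.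
by rewrite minC maxC.
Qed.

(** A continuous F need not attain 0 or 1, hence the tolerance: interior values are attained, the
    two ends are approached through the limits at infinity. *)
Lemma distr_fun_dense (u e : R) : 0 <= u <= 1 -> 0 < e -> exists x, `|F x - u| <= e.
Proof.
move=> /andP[]; rewrite le_eqVlt => /orP[/eqP<- _ e0|u0].
  have [x Fx] := distr_fun_near0 e0; exists x.
  have /andP[? ?] := distr_fun01 x; rewrite subr0 ger0_norm//; lra.
rewrite le_eqVlt => /orP[/eqP-> e0|u1 e0].
  have [x Fx] := distr_fun_near1 e0; exists x.
  by have /andP[? ?] := distr_fun01 x; rewrite distrC ger0_norm; lra.
have [|x Fx] := @distr_fun_surj u; first by rewrite u0.
by exists x; rewrite Fx subrr normr0 ltW.
Qed.

(** Interior entries are exact quantiles, which exist by continuity; the end entries are infinite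
    because 0 and 1 may not be attained. *)
Lemma distr_fun_grid : exists xs : nat -> nat -> \bar R, forall m, (0 < m)%N ->
  [/\ xs m 0%N = -oo%E, xs m m = +oo%E & forall i, (i <= m)%N ->
    fine (P [set w | ((V w)%:E <= xs m i)%E]) = i%:R / m%:R].
Proof.
exists (fun m i => if i == 0%N then -oo%E else if (m <= i)%N then +oo%E else
  (xget 0 [set x | F x = i%:R / m%:R])%:E) => m m0.
split; first by [].
  by rewrite leqnn; case: eqP => // m00; move: m0; rewrite m00.
have m0' : 0 < m%:R :> R by rewrite ltr0n.
move=> i im; have [->|i0] := eqVneq i 0%N.
  rewrite mul0r (_ : [set _ | _] = set0) ?measure0//.
  by apply/seteqP; split => w //=; rewrite leeNy_eq.
have [mi|mi] := leqP m i.
  have -> : i = m by apply/eqP; rewrite eqn_leq im.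
  rewrite mulfV ?gt_eqF// (_ : [set _ | _] = setT) ?probability_setT//.
  by apply/seteqP; split => w //= _; rewrite leey.
have : exists x, F x = i%:R / m%:R.
  apply: distr_fun_surj; rewrite divr_gt0// ?ltr0n ?lt0n//=.
  by rewrite ltr_pdivrMr// mul1r ltr_nat.
by move=> /(xgetPex 0) /=.
Qed.

End distribution_function.

(** The sections of H approximate F uniformly in x, with an error 1 - g y that can be made small, so
    continuity passes to F. *)
Lemma continuous_marginal (R : realType) (F g : R -> R) (H : R -> R -> R) :
  (forall x y, `|F x - H x y| <= 1 - g y) -> g y @[y --> +oo] --> (1 : R) ->
  (forall y, continuous (H^~ y)) -> continuous F.
Proof.
move=> FH g1 cH x; apply/cvgrPdist_lt => e e0.
have e3 : 0 < e / 3 by rewrite divr_gt0.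
have /cvgrPdist_lt/(_ _ e3) := g1.
move=> /filter_ex[y gy].
have {}gy : 1 - g y < e / 3 by move: gy; rewrite ltr_norml => /andP[]; lra.
have /cvgrPdist_lt/(_ _ e3) := cH y x; apply: filterS => x'.
have := FH x y; have := FH x' y.
rewrite !ler_norml !ltr_norml => /andP[? ?] /andP[? ?] /andP[? ?].
by apply/andP; split; lra.
Qed.

Section sample.
Context {R : realType} {d : measure_display} {T : measurableType d}.
Variables (P : probability T R) (X Y : nat -> T -> R).
Hypothesis mX : forall i, measurable_fun setT (X i).
Hypothesis mY : forall i, measurable_fun setT (Y i).
Local Notation Z := (fun i w => (X i w, Y i w)).
Local Notation law := (law P Z).
Local Notation emp := (emp Z).
Local Notation F := (distr_fun P (X 0%N)).
Local Notation G := (distr_fun P (Y 0%N)).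
Local Notation H := (joint_distr_fun P (X 0%N) (Y 0%N)).

Lemma measurable_sample i : measurable_fun setT (Z i).
Proof. exact: measurable_fun_pair. Qed.

Lemma law_joint x y : law (quadrant x%:E y%:E) = H x y.
Proof. by rewrite /law /joint_distr_fun. Qed.

Lemma law_left a : law (quadrant a +oo) = fine (P [set w | ((X 0%N w)%:E <= a)%E]).
Proof.
congr (fine (P _)); apply/seteqP; split => w /=; first by case.
by split => //=; rewrite leey.
Qed.

Lemma law_right a : law (quadrant +oo a) = fine (P [set w | ((Y 0%N w)%:E <= a)%E]).
Proof.
congr (fine (P _)); apply/seteqP; split => w /=; first by case.
by split => //=; rewrite leey.
Qed.

Lemma emp_joint n w x y : emp n w (quadrant x%:E y%:E) = emp_joint_df X Y n w x y.
Proof.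
rewrite /emp /emp_joint_df; congr (_ / _); apply: eq_bigr => i _.
congr (nat_of_bool _)%:R; apply/idP/idP => [/set_mem[/= ? ?]|/andP[? ?]].
  by apply/andP.
exact/mem_set.
Qed.

Lemma emp_left n w x : emp n w (quadrant x%:E +oo) = emp_df X n w x.
Proof.
rewrite /emp /emp_df; congr (_ / _); apply: eq_bigr => i _.
congr (nat_of_bool _)%:R; apply/idP/idP => [/set_mem[/= ? ?]//|?].
by apply/mem_set; split => //=; rewrite leey.
Qed.

Lemma emp_right n w x : emp n w (quadrant +oo x%:E) = emp_df Y n w x.
Proof.
rewrite /emp /emp_df; congr (_ / _); apply: eq_bigr => i _.
congr (nat_of_bool _)%:R; apply/idP/idP => [/set_mem[/= ? ?]//|?].
by apply/mem_set; split => //=; rewrite leey.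
Qed.

Lemma law_setT : law (quadrant +oo +oo) = 1.
Proof.
rewrite law_left (_ : [set _ | _] = setT) ?probability_setT//.
by apply/seteqP; split => w //= _; rewrite leey.
Qed.

Hypothesis cH : continuous (fun xy : (R * R)%type => H xy.1 xy.2).

Lemma joint_continuous_left : continuous F.
Proof.
apply: (@continuous_marginal _ F G H).
- move=> x y; have mZ := measurable_sample.
  have mq := @measurable_quadrant R.
  (* Enlarging the quadrant to the half-plane X <= x adds at most the mass 1 - G y of Y > y. *)
  have := law_quadrant_lip P mZ (lexx x%:E) (leey y%:E).
  have := law_mono P mZ (mq _ _) (mq _ _) (quadrant_sub (lexx x%:E) (leey y%:E)).
  rewrite law_setT subrr add0r law_joint law_left law_right => *.
  by rewrite ger0_norm ?subr_ge0.
- exact: distr_fun_cvgy1 (mY 0%N).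
- move=> y x; have c : (x', y) @[x' --> x] --> (x, y).
    exact: (cvg_pair cvg_id (cvg_cst y)).
  exact: (cvg_comp _ (fun xy => H xy.1 xy.2) c (@cH (x, y))).
Qed.

Lemma joint_continuous_right : continuous G.
Proof.
apply: (@continuous_marginal _ G F (fun y x => H x y)).
- move=> y x; have mZ := measurable_sample.
  have mq := @measurable_quadrant R.
  have := law_quadrant_lip P mZ (leey x%:E) (lexx y%:E).
  have := law_mono P mZ (mq _ _) (mq _ _) (quadrant_sub (leey x%:E) (lexx y%:E)).
  rewrite law_setT subrr addr0 law_joint law_left law_right => *.
  by rewrite ger0_norm ?subr_ge0.
- exact: distr_fun_cvgy1 (mX 0%N).
- move=> x y; have c : (x, y') @[y' --> y] --> (x, y).
    exact: (cvg_pair (cvg_cst x) cvg_id).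
  exact: (cvg_comp _ (fun xy => H xy.1 xy.2) c (@cH (x, y))).
Qed.

Lemma empirical_df_rate (r : R) : iid P Z -> 0 < r < 1 / 2 ->
  {ae P, forall w, \forall n \near \oo,
    [/\ forall x, `|emp_df X n w x - F x| <= 3 * n%:R `^ (- r),
        forall y, `|emp_df Y n w y - G y| <= 3 * n%:R `^ (- r) &
        forall x y, `|emp_joint_df X Y n w x y - H x y| <= 3 * n%:R `^ (- r)]}.
Proof.
move=> iidZ r01.
have [xs Hx] := distr_fun_grid (mX 0%N) joint_continuous_left.
have [ys Hy] := distr_fun_grid (mY 0%N) joint_continuous_right.
have : {ae P, forall w, \forall n \near \oo, forall a b,
    `|emp n w (quadrant a b) - law (quadrant a b)| <= 3 * n%:R `^ (- r)}.
  apply: (@glivenko_cantelli_rate R d T P Z measurable_sample iidZ r xs ys r01).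
    by move=> m /Hx[? ? Hi]; split => // i im; rewrite law_left Hi.
  by move=> m /Hy[? ? Hi]; split => // i im; rewrite law_right Hi.
apply: filterS => w; apply: filterS => n dev; split.
- by move=> x; rewrite -emp_left; have := dev x%:E +oo%E; rewrite law_left.
- by move=> y; rewrite -emp_right; have := dev +oo%E y%:E; rewrite law_right.
- by move=> x y; rewrite -emp_joint -law_joint.
Qed.

End sample.

(** * Empirical copulas *)

Lemma card_rank_lt n (rank : 'I_n -> nat) m : injective rank ->
  (forall k, (rank k < n)%N) -> (m <= n)%N -> #|[set k | (rank k < m)%N]%SET| = m.
Proof.
move=> rinj rn mn; pose f k := Ordinal (rn k).
have finj : injective f by move=> k l /(congr1 val)/rinj.
rewrite -(card_imset _ finj).
have -> : (f @: [set k | (rank k < m)%N] = [set j : 'I_n | (j < m)%N])%SET.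
  apply/setP => j; rewrite inE; apply/imsetP/idP => [[k]|jm].
    by rewrite inE => km ->.
  have [g fg gf] := injF_bij finj.
  by exists (g j); rewrite ?gf// inE -[rank _]/(val (f (g j))) gf.
by rewrite -sum1dep_card -(big_ord_widen _ (fun=> 1%N) mn) sum1_card card_ord.
Qed.

(* Ties are broken by the index. *)
Lemma exists_rank (R : realType) n (x : 'I_n -> R) : exists rank : 'I_n -> nat,
  [/\ forall k, (rank k < n)%N,
      forall m, (m <= n)%N -> #|[set k | (rank k < m)%N]%SET| = m &
      forall t k, (x k <= t) = (rank k < #|[set l | (x l <= t)%R]%SET|)%N].
Proof.
pose before (i k : 'I_n) := (x i < x k) || ((x i == x k) && (i < k)%N).
have bb k : before k k = false by rewrite /before ltxx ltnn andbF.
have btr i k l : before i k -> before k l -> before i l.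
  rewrite /before => /orP[ik|/andP[/eqP-> ik]] /orP[kl|/andP[/eqP<- kl]].
  - by rewrite (lt_trans ik kl).
  - by rewrite ik.
  - by rewrite kl.
  - by rewrite eqxx (ltn_trans ik kl) orbT.
have btot i k : i != k -> before i k || before k i.
  rewrite /before; case: (ltgtP (x i) (x k)) => //= _ ik.
  by rewrite -neq_ltn.
pose rank k := #|[set i | before i k]%SET|.
have rlt k l : before k l -> (rank k < rank l)%N.
  move=> kl; apply: proper_card; apply/properP; split.
    by apply/fintype.subsetP => i; rewrite !inE => /btr; apply.
  by exists k; rewrite !inE ?bb.
have rn k : (rank k < n)%N.
  rewrite -[X in (_ < X)%N](card_ord n) -cardsT; apply: proper_card.
  by apply/properP; split; [exact/fintype.subsetP|exists k; rewrite !inE ?bb].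
have rinj : injective rank.
  move=> k l kl; apply/eqP; apply: contraT => /btot /orP[] /rlt;
  by rewrite kl ltnn.
exists rank; split => // [m|t k]; first exact: card_rank_lt.
(* If x k <= t, all predecessors of k also have values at most t, and k itself makes the inclusion
   strict. Otherwise every index with value at most t precedes k. *)
have [kt|kt] := leP (x k) t; apply/esym.
  apply: proper_card; apply/properP; split; last by exists k; rewrite !inE ?bb.
  apply/fintype.subsetP => i; rewrite !inE => /orP[/ltW ik|/andP[/eqP-> _]//].
  exact: le_trans kt.
apply/negbTE; rewrite -leqNgt; apply: subset_leq_card.
apply/fintype.subsetP => i; rewrite !inE => it.
by rewrite /before (le_lt_trans it kt).
Qed.

(** By the 2-increasing property the increment in u at height v lies between those at heights 0 and
    1, namely 0 and u' - u. The domain [S] is abstract so that both the unit interval and the grid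
    qualify. *)
Lemma subcopula_lipschitz (R : realType) (S : R -> Prop) (C : R -> R -> R) :
  S 0 -> S 1 -> (forall u, S u -> 0 <= u <= 1) ->
  (forall u, S u -> C u 0 = 0 /\ C 0 u = 0 /\ C u 1 = u /\ C 1 u = u) ->
  (forall u1 u2 v1 v2, S u1 -> S u2 -> S v1 -> S v2 -> u1 <= u2 -> v1 <= v2 ->
     0 <= C u2 v2 - C u2 v1 - C u1 v2 + C u1 v1) ->
  forall u u' v v', S u -> S u' -> S v -> S v' ->
    `|C u v - C u' v'| <= `|u - u'| + `|v - v'|.
Proof.
move=> S0 S1 S01 mC iC.
have l1 u u' v : S u -> S u' -> S v -> u <= u' -> `|C u v - C u' v| <= u' - u.
  move=> Su Su' Sv uu'; have /andP[v0 v1] := S01 _ Sv.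
  have := iC _ _ _ _ Su Su' S0 Sv uu' v0; have := iC _ _ _ _ Su Su' Sv S1 uu' v1.
  have [-> [_ [-> _]]] := mC _ Su; have [-> [_ [-> _]]] := mC _ Su'.
  by move=> *; rewrite ler_norml; apply/andP; split; lra.
have l2 u v v' : S u -> S v -> S v' -> v <= v' -> `|C u v - C u v'| <= v' - v.
  move=> Su Sv Sv' vv'; have /andP[u0 u1] := S01 _ Su.
  have := iC _ _ _ _ S0 Su Sv Sv' u0 vv'; have := iC _ _ _ _ Su S1 Sv Sv' u1 vv'.
  have [_ [-> [_ ->]]] := mC _ Sv; have [_ [-> [_ ->]]] := mC _ Sv'.
  by move=> *; rewrite ler_norml; apply/andP; split; lra.
move=> u u' v v' Su Su' Sv Sv'.
apply: (le_trans (ler_distD (C u' v) _ _)); apply: lerD.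
  have [h|/ltW h] := leP u u'.
    by rewrite (distrC u) (ger0_norm (_ : 0 <= u' - u)) ?subr_ge0//; exact: l1.
  by rewrite distrC (ger0_norm (_ : 0 <= u - u')) ?subr_ge0//; exact: l1.
have [h|/ltW h] := leP v v'.
  by rewrite (distrC v) (ger0_norm (_ : 0 <= v' - v)) ?subr_ge0//; exact: l2.
by rewrite distrC (ger0_norm (_ : 0 <= v - v')) ?subr_ge0//; exact: l2.
Qed.

Lemma copula_lipschitz (R : realType) (A : R -> R -> R) u u' v v' : is_copula A ->
  in01 u -> in01 u' -> in01 v -> in01 v' ->
  `|A u v - A u' v'| <= `|u - u'| + `|v - v'|.
Proof.
move=> [mA iA]; apply: (@subcopula_lipschitz _ (@in01 R)) => //.
- by rewrite /in01 in_itv/= lexx ler01.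
- by rewrite /in01 in_itv/= lexx ler01.
Qed.

Section grid.
Variables (R : realType) (n : nat).
Hypothesis n0 : (0 < n)%N.

Lemma grid0 : grid R n 0 = 0. Proof. by rewrite /grid mul0r. Qed.

Lemma gridn : grid R n n = 1.
Proof. by rewrite /grid mulfV// pnatr_eq0 -lt0n. Qed.

Lemma gridK k : n%:R * grid R n k = k%:R.
Proof. by rewrite /grid mulrCA mulfV ?mulr1// pnatr_eq0 -lt0n. Qed.

Lemma le_grid i j : (grid R n i <= grid R n j) = (i <= j)%N.
Proof. by rewrite /grid ler_pM2r ?ler_nat// invr_gt0 ltr0n. Qed.

Lemma grid01 k : (k <= n)%N -> in01 (grid R n k).
Proof. by move=> kn; rewrite /in01 in_itv/= -{1}grid0 -gridn !le_grid kn. Qed.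

Lemma grid_subcopula_lipschitz (E : R -> R -> R) i i' j j' : grid_subcopula n E ->
  (i <= n)%N -> (i' <= n)%N -> (j <= n)%N -> (j' <= n)%N ->
  `|E (grid R n i) (grid R n j) - E (grid R n i') (grid R n j')|
    <= `|grid R n i - grid R n i'| + `|grid R n j - grid R n j'|.
Proof.
move=> [mE iE] ? ? ? ?.
apply: (@subcopula_lipschitz _ (fun u => exists2 k, (k <= n)%N & u = grid R n k)).
- by exists 0%N; rewrite ?grid0.
- by exists n; rewrite ?gridn.
- by move=> _ [k kn ->]; have := grid01 kn; rewrite /in01 in_itv.
- by move=> _ [k kn ->]; exact: mE.
- move=> _ _ _ _ [a an ->] [b bn ->] [c cn ->] [e en ->]; rewrite !le_grid => ab ce.
  by apply: iE; rewrite ?ab ?ce.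
- by exists i.
- by exists i'.
- by exists j.
- by exists j'.
Qed.

End grid.

Section empirical_copula.
Context {R : realType} {T : Type}.
Variables (X Y : nat -> T -> R) (n : nat) (w : T).
Hypothesis n0 : (0 < n)%N.

Lemma emp_df_grid (V : nat -> T -> R) x :
  emp_df V n w x = grid R n #|[set l : 'I_n | (V l w <= x)%R]%SET|.
Proof.
rewrite /emp_df /grid -natr_sum -sum1_card [in RHS]big_mkcond/=.
by congr (_%:R / _); apply: eq_bigr => i _; rewrite inE; case: ifP.
Qed.

(** The subcopula counts the sample through its pairs of ranks. As the ranks form a permutation even
    with ties, exactly m of them lie below m, which makes the margins uniform. *)
Lemma emp_subcopula_exists : exists E, is_emp_subcopula X Y n w E.
Proof.
have [p [pn pc px]] := exists_rank (fun k : 'I_n => X k w).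
have [q [qn qc qy]] := exists_rank (fun k : 'I_n => Y k w).
(* Ranks start at 0, so the strict inequality at u = i/n selects exactly i of them. *)
pose E (u v : R) : R := (\sum_(k < n)
  (((p k)%:R < n%:R * u) && ((q k)%:R < n%:R * v) : nat)%:R) / n%:R.
have EE i j : E (grid R n i) (grid R n j) =
    (\sum_(k < n) (((p k < i) && (q k < j))%N : nat)%:R) / n%:R.
  by congr (_ / _); apply: eq_bigr => k _; rewrite !gridK// !ltr_nat.
have card0 (D : {set 'I_n}) : \sum_(k < n) ((k \in D) : nat)%:R = #|D|%:R :> R.
  by rewrite -natr_sum -sum1_card [in RHS]big_mkcond.
have sum0 (h : 'I_n -> bool) : (forall k, h k = false) ->
    (\sum_(k < n) (h k : nat)%:R) / n%:R = 0 :> R.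
  by move=> h0; rewrite big1 ?mul0r// => k _; rewrite h0.
exists E; split; last first.
  move=> x y; rewrite !emp_df_grid EE /emp_joint_df; congr (_ / _).
  by apply: eq_bigr => k _; rewrite px qy.
split.
  move=> k kn; rewrite -(grid0 R n) -(gridn R n0) !EE; do !split.
  - by rewrite sum0 ?grid0// => l; rewrite andbF.
  - by rewrite sum0 ?grid0.
  - rewrite /grid -[in RHS](pc k kn) -card0; congr (_ / _); apply: eq_bigr => l _.
    by rewrite inE qn andbT.
  - rewrite /grid -[in RHS](qc k kn) -card0; congr (_ / _); apply: eq_bigr => l _.
    by rewrite inE pn.
move=> i1 i2 j1 j2 /andP[i12 _] /andP[j12 _].
rewrite !EE -!mulrBl -mulrDl divr_ge0// -!sumrB -big_split/=.
apply: sumr_ge0 => k _.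
have lei : (p k < i1)%N -> (p k < i2)%N by move=> /leq_trans; apply.
have lej : (q k < j1)%N -> (q k < j2)%N by move=> /leq_trans; apply.
move: lei lej.
case: (p k < i1)%N => [/(_ isT)->|_]; case: (q k < j1)%N => [/(_ isT)->|_];
  case: (p k < i2)%N; case: (q k < j2)%N => /=; lra.
Qed.

Variables (A : R -> R -> R) (F G : R -> R) (H : R -> R -> R) (D : R).
Hypothesis cA : is_copula A.
Hypothesis HA : forall x y, H x y = A (F x) (G y).
Hypothesis F01 : forall x, 0 <= F x <= 1.
Hypothesis G01 : forall x, 0 <= G x <= 1.
Hypothesis Fd : forall u e : R, 0 <= u <= 1 -> 0 < e -> exists x, `|F x - u| <= e.
Hypothesis Gd : forall u e : R, 0 <= u <= 1 -> 0 < e -> exists x, `|G x - u| <= e.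
Hypothesis D0 : 0 < D.
Hypothesis Dn : n%:R^-1 <= D.
Hypothesis FD : forall x, `|emp_df X n w x - F x| <= D.
Hypothesis GD : forall y, `|emp_df Y n w y - G y| <= D.
Hypothesis HD : forall x y, `|emp_joint_df X Y n w x y - H x y| <= D.

(** Take x, y with F x, G y within D of the grid point; then F_n x, G_n y are within 2D of it. The
    total is 4D from the Lipschitz bound for [E], D from H_n - H and 2D from the Lipschitz bound for
    [A]. *)
Lemma emp_subcopula_dev E i j : is_emp_subcopula X Y n w E ->
  (i <= n)%N -> (j <= n)%N ->
  `|E (grid R n i) (grid R n j) - A (grid R n i) (grid R n j)| <= 7 * D.
Proof.
move=> [sE EH] ni nj.
have gi := grid01 R n0 ni; have gj := grid01 R n0 nj.
have [x Fx] : exists x, `|F x - grid R n i| <= D.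
  by apply: Fd => //; move: gi; rewrite /in01 in_itv.
have [y Gy] : exists y, `|G y - grid R n j| <= D.
  by apply: Gd => //; move: gj; rewrite /in01 in_itv.
have := FD x; have := GD y; have := HD x y.
rewrite EH HA !emp_df_grid.
set k := #|_|; set l := #|_|.
move=> h1 h2 h3.
have kn : (k <= n)%N by rewrite -[X in (_ <= X)%N](card_ord n) max_card.
have ln : (l <= n)%N by rewrite -[X in (_ <= X)%N](card_ord n) max_card.
have L1 := grid_subcopula_lipschitz n0 sE ni kn nj ln.
have iF : in01 (F x) by rewrite /in01 in_itv; exact: F01.
have iG : in01 (G y) by rewrite /in01 in_itv; exact: G01.
have L2 := copula_lipschitz cA iF gi iG gj.
have ha : `|grid R n i - grid R n k| <= 2 * D.
  apply: (le_trans (ler_distD (F x) _ _)).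
  by move: h3 Fx; rewrite (distrC _ (F x)) (distrC (F x) (grid R n k)); lra.
have hb : `|grid R n j - grid R n l| <= 2 * D.
  apply: (le_trans (ler_distD (G y) _ _)).
  by move: h2 Gy; rewrite (distrC _ (G y)) (distrC (G y) (grid R n l)); lra.
apply: (le_trans (ler_distD (E (grid R n k) (grid R n l)) _ _)).
have := ler_distD (A (F x) (G y)) (E (grid R n k) (grid R n l)) (A (grid R n i) (grid R n j)).
lra.
Qed.

Lemma bilinear_cell u : in01 u ->
  let i := minn (Num.truncn (n%:R * u)) n.-1 in
  [/\ (i.+1 <= n)%N, 0 <= n%:R * u - i%:R <= 1, in01 (grid R n i) /\ in01 (grid R n i.+1),
      `|grid R n i - u| <= D & `|grid R n i.+1 - u| <= D].
Proof.
move=> u01 i; have /andP[u0 u1] : 0 <= u <= 1 by move: u01; rewrite /in01 in_itv.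
have n0' : 0 < n%:R :> R by rewrite ltr0n.
have nu0 : 0 <= n%:R * u by rewrite mulr_ge0.
have nun : n%:R * u <= n%:R by rewrite ger_pMr.
have in_ : (i.+1 <= n)%N by rewrite -[X in (_ <= X)%N](prednK n0) ltnS geq_minr.
have /andP[t1 t2] := truncn_itv nu0.
have a01 : 0 <= n%:R * u - i%:R <= 1.
  (* The cap at n - 1 acts only at u = 1, which thereby falls into the last cell with local
     coordinate 1. *)
  rewrite /i; case: (leqP (Num.truncn (n%:R * u)) n.-1) => h.
    by rewrite subr_ge0 t1/= lerBlDl natr1 ltW.
  have : n.-1.+1%:R <= n%:R * u :> R by apply: le_trans t1; rewrite ler_nat.
  by rewrite prednK// -[X in X%:R <= _](prednK n0) -natr1 -[X in _ * _ - X]addr0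
    => h1; apply/andP; split; [lra|
    move: nun; rewrite -[X in _ <= X%:R](prednK n0) -natr1; lra].
have D' x : `|x - n%:R * u| <= 1 -> `|x / n%:R - u| <= D.
  move=> hx; apply: le_trans Dn.
  rewrite -[u in leLHS](mulfK (lt0r_neq0 n0')) (mulrC u) -mulrBl normrM.
  by rewrite [`|_^-1|]gtr0_norm ?invr_gt0// ger_pMl ?invr_gt0.
split => //.
- by split; apply: grid01 => //; exact: ltnW.
- by apply: D'; rewrite distrC; move: a01 => /andP[? ?]; rewrite ger0_norm.
- apply: D'; rewrite -natr1; move: a01 => /andP[? ?].
  by rewrite ler_norml; apply/andP; split; lra.
Qed.

(** The interpolation is a convex combination of corner values. Each corner contributes 7D, plus 2D
    for moving the argument of [A] from the corner to (u, v). *)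
Lemma emp_copula_dev u v : in01 u -> in01 v ->
  `|emp_copula X Y n w u v - A u v| <= 9 * D.
Proof.
move=> u01 v01; rewrite /emp_copula.
have : [set E | is_emp_subcopula X Y n w E]
    (xget (fun _ _ => 0) [set E' | is_emp_subcopula X Y n w E']).
  exact: xgetPex emp_subcopula_exists.
move: (xget _ _) => E /= sE.
have [i1 a01 [gi gi'] di di'] := bilinear_cell u01.
have [j1 b01 [gj gj'] dj dj'] := bilinear_cell v01.
rewrite /bilinear_extension.
move: (minn _ _) i1 a01 gi gi' di di' => i i1 a01 gi gi' di di'.
move: (minn _ _) j1 b01 gj gj' dj dj' => j j1 b01 gj gj' dj dj'.
move: (_ - _) a01 => a /andP[a0 a1]; move: (_ - _) b01 => b /andP[b0 b1].
have dev k l : (k <= n)%N -> (l <= n)%N -> `|grid R n k - u| <= D ->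
    `|grid R n l - v| <= D -> `|E (grid R n k) (grid R n l) - A u v| <= 9 * D.
  move=> kn ln ku lv.
  have := emp_subcopula_dev sE kn ln.
  have := copula_lipschitz cA (grid01 R n0 kn) u01 (grid01 R n0 ln) v01.
  have := ler_distD (A (grid R n k) (grid R n l)) (E (grid R n k) (grid R n l)) (A u v).
  lra.
have := dev _ _ (ltnW i1) (ltnW j1) di dj; have := dev _ _ i1 (ltnW j1) di' dj.
have := dev _ _ (ltnW i1) j1 di dj'; have := dev _ _ i1 j1 di' dj'.
move: (E _ _) => e11; move: (E _ _) => e01; move: (E _ _) => e10; move: (E _ _) => e00.
have a0' : 0 <= 1 - a by lra.
have b0' : 0 <= 1 - b by lra.
have w1 := mulr_ge0 a0' b0'; have w2 := mulr_ge0 a0 b0'.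
have w3 := mulr_ge0 a0' b0; have w4 := mulr_ge0 a0 b0.
move=> d11 d01 d10 d00.
have -> : (1 - a) * (1 - b) * e00 + a * (1 - b) * e10 + (1 - a) * b * e01
    + a * b * e11 - A u v = (1 - a) * (1 - b) * (e00 - A u v)
    + a * (1 - b) * (e10 - A u v) + (1 - a) * b * (e01 - A u v)
    + a * b * (e11 - A u v) by ring.
have -> : 9 * D = (1 - a) * (1 - b) * (9 * D)
    + a * (1 - b) * (9 * D) + (1 - a) * b * (9 * D) + a * b * (9 * D) by ring.
apply: (le_trans (ler_normD _ _)); apply: lerD; last first.
  by rewrite normrM ger0_norm// ler_wpM2l.
apply: (le_trans (ler_normD _ _)); apply: lerD; last first.
  by rewrite normrM ger0_norm// ler_wpM2l.
apply: (le_trans (ler_normD _ _)); apply: lerD.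
  by rewrite normrM ger0_norm// ler_wpM2l.
by rewrite normrM ger0_norm// ler_wpM2l.
Qed.

End empirical_copula.

(** * Bernstein kernels *)

Section bernstein.
Context {R : realType}.
Implicit Types (u v : R) (N k : nat).

Lemma bern_ge0 N k u : 0 <= u <= 1 -> 0 <= bern N k u.
Proof.
move=> /andP[u0 u1]; rewrite /bern; case: ifP => // _.
by rewrite !mulr_ge0 ?exprn_ge0 ?subr_ge0.
Qed.

Lemma bern_small N k u : (N < k)%N -> bern N k u = 0.
Proof. by move=> Nk; rewrite /bern leqNgt Nk. Qed.

Lemma bernS0 N u : bern N.+1 0 u = (1 - u) * bern N 0 u.
Proof. by rewrite /bern !leq0n !bin0 !subn0 !expr0 exprS; ring. Qed.

Lemma bernSS N k u :
  bern N.+1 k.+1 u = u * bern N k u + (1 - u) * bern N k.+1 u.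
Proof.
rewrite /bern ltnS; case: ifP => [kN|/negbT]; last first.
  by rewrite -ltnNge => kN; rewrite ifF ?mulr0 ?addr0// ltnNge (ltnW kN).
rewrite binS natrD subSS; case: ifP => [k1N|/negbT].
  have -> : (N - k = (N - k.+1).+1)%N by rewrite -subSn// subSS.
  by rewrite !exprS; ring.
rewrite -leqNgt => Nk; have -> : k = N by apply/eqP; rewrite eqn_leq kN.
by rewrite bin_small// exprS; ring.
Qed.

(** Conditioning a binomial variable on one of its trials: E g(S_(N+1)) = u E g(S_N + 1) + (1 - u) E
    g(S_N). *)
Lemma sum_bernS (g : nat -> R) N u :
  \sum_(k < N.+2) g k * bern N.+1 k u =
  u * \sum_(k < N.+1) g k.+1 * bern N k u + (1 - u) * \sum_(k < N.+1) g k * bern N k u.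
Proof.
have -> : \sum_(k < N.+1) g k * bern N k u = \sum_(k < N.+2) g k * bern N k u.
  by rewrite [RHS]big_ord_recr/= bern_small// mulr0 addr0.
rewrite !(big_ord_recl N.+1)/= bernS0 mulrDr !mulr_sumr addrCA -big_split/=.
congr (_ + _); first by ring.
by apply: eq_bigr => i _; rewrite /bump/= add1n bernSS; ring.
Qed.

Lemma sum_bern N u : \sum_(k < N.+1) bern N k u = 1.
Proof.
elim: N => [|N IH].
  by rewrite big_ord_recr big_ord0/= /bern/= bin0 !expr0 add0r !mulr1.
have E n m : \sum_(k < n) 1 * bern m k u = \sum_(k < n) bern m k u.
  by apply: eq_bigr => k _; rewrite mul1r.
by have /= := sum_bernS (fun=> 1) N u; rewrite !E IH => ->; ring.
Qed.

(** Squared bias plus variance of the binomial law. The centre c is free because the induction step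
    replaces it by c - 1. *)
Lemma sum_bern_sqr N u c :
  \sum_(k < N.+1) (k%:R - c) ^+ 2 * bern N k u =
  (N%:R * u - c) ^+ 2 + N%:R * (u * (1 - u)).
Proof.
elim: N c => [|N IH] c.
  by rewrite big_ord_recr big_ord0/= /bern/= bin0 !expr0; ring.
rewrite (sum_bernS (fun k => (k%:R - c) ^+ 2)) IH/=.
have -> : \sum_(k < N.+1) (k.+1%:R - c) ^+ 2 * bern N k u =
    \sum_(k < N.+1) (k%:R - (c - 1)) ^+ 2 * bern N k u.
  by apply: eq_bigr => k _; rewrite -natr1; congr (_ ^+ 2 * _); ring.
rewrite IH.
by rewrite -natr1; ring.
Qed.

Lemma sum_bern_sqr_le N u : 0 <= u <= 1 ->
  \sum_(k < N.+1) (k%:R - N%:R * u) ^+ 2 * bern N k u <= N%:R / 4.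
Proof.
move=> u01; rewrite sum_bern_sqr subrr expr0n/= add0r ler_wpM2l//.
by have := sqr_ge0 (1 - 2 * u); rewrite expr2; lra.
Qed.

Lemma sum_bern2 M N (u v : R) :
  \sum_(i < M.+1) \sum_(j < N.+1) bern M i u * bern N j v = 1.
Proof.
under eq_bigr do rewrite -mulr_sumr sum_bern mulr1.
exact: sum_bern.
Qed.

Lemma sum_by_parts (a p : nat -> R) m :
  \sum_(i < m) a i.+1 * (p i - p i.+1) =
  \sum_(i < m) (a i.+1 - a i) * p i + a 0%N * p 0%N - a m * p m.
Proof.
elim: m => [|m IH]; first by rewrite !big_ord0; ring.
by rewrite !big_ord_recr/= IH; ring.
Qed.

(** The boundary terms of the summation by parts vanish because B(0, v) = 0 and the weight of index
    M + 1 in degree M is zero. The null terms with j = 0 are included so that the weights sum to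
    1. *)
Lemma bernstein_kernelE (B : R -> R -> R) M (x y : R) :
  (forall v, 0 <= v <= 1 -> B 0 v = 0 /\ B v 0 = 0) ->
  let N := M.+1 in
  bernstein_kernel N B x y = \sum_(i < N) \sum_(j < N.+1)
    N%:R * (B (i.+1%:R / N%:R) (j%:R / N%:R) - B (i%:R / N%:R) (j%:R / N%:R)) *
    (bern M i x * bern N j y).
Proof.
move=> B0 N; have N0 : 0 < N%:R :> R by rewrite ltr0n.
have fN k : (k <= N)%N -> 0 <= (k%:R / N%:R : R) <= 1.
  by move=> kN; rewrite divr_ge0//= ler_pdivrMr// mul1r ler_nat.
rewrite /bernstein_kernel big_add1/= big_mkord.
under [in LHS]eq_bigr do rewrite big_add1/= big_mkord.
rewrite exchange_big/= [RHS]exchange_big/= [RHS]big_ord_recl/=.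
rewrite [X in _ = X + _]big1 ?add0r; last first.
  move=> i _; rewrite mul0r; have [_ ->] := B0 _ (fN i.+1 (ltn_ord i)).
  by have [_ ->] := B0 _ (fN i (ltnW (ltn_ord i))); rewrite subrr mulr0 mul0r.
rewrite mulr_sumr; apply: eq_bigr => j _.
rewrite -mulr_suml.
rewrite (sum_by_parts (fun i => B (i%:R / N%:R) (j.+1%:R / N%:R)) (fun i => bern M i x)).
rewrite (bern_small x (ltnSn M)) mulr0 subr0 [X in B X _ * _]mul0r.
have [-> _] := B0 _ (fN j.+1 (ltn_ord j)); rewrite !mul0r addr0.
rewrite mulr_suml mulr_sumr; apply: eq_bigr => i _.
by rewrite /bump/= add1n; ring.
Qed.

End bernstein.

Lemma compact_uniform_continuity (R : realType) (f : R -> R -> R) :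
  {within `[0, 1]%classic `*` `[0, 1]%classic,
    continuous (fun xy : (R * R)%type => f xy.1 xy.2)} ->
  forall e, 0 < e -> exists2 del, 0 < del & forall x x' y y',
    in01 x -> in01 x' -> in01 y -> in01 y' -> `|x - x'| < del -> `|y - y'| < del ->
    `|f x y - f x' y'| < e.
Proof.
move=> cf e e0.
have e2 : 0 < e / 2 by rewrite divr_gt0.
pose K : set (R * R) := `[0, 1]%classic `*` `[0, 1]%classic.
have cK : compact K by apply: compact_setX; exact: segment_compact.
have : \forall del \near 0^'+, K `<=` [set p : R * R | forall q : R * R, K q ->
    `|p.1 - q.1| < del -> `|p.2 - q.2| < del -> `|f p.1 p.2 - f q.1 q.2| < e].
  move/compact_near_coveringP/near_covering_withinP : cK; apply => p Kp.
  have /subspace_continuousP/(_ _ Kp)/cvgrPdist_lt/(_ _ e2) := cf.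
  rewrite /within/= => -[[U V] /= [/nbhs_ballP[r1 /= r10 U1] /nbhs_ballP[r2 /= r20 V2]] UV].
  pose r := Num.min r1 r2.
  have r0 : 0 < r by rewrite lt_min r10.
  have close (q : R * R) : K q -> `|p.1 - q.1| < r -> `|p.2 - q.2| < r ->
      `|f p.1 p.2 - f q.1 q.2| < e / 2.
    rewrite !lt_min => Kq /andP[h1 _] /andP[_ h2]; apply: (UV q) => //.
    by split; [exact: U1|exact: V2].
  (* Half radii keep both p' and q within r of p. *)
  exists (ball p (r / 2), [set del | del < r / 2]).
    by split; [apply: nbhsx_ballx; lra|apply: nbhs_right_lt; lra].
  move=> [p' del] /= [[/= b1 b2] dr] Kp' q Kq h1 h2.
  have := close _ Kp'; have := close _ Kq.
  have t1 := ler_distD p'.1 p.1 q.1; have t2 := ler_distD p'.2 p.2 q.2.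
  move: b1 b2; rewrite /ball/= => b1 b2 g1 g2.
  have {}g1 := g1 (le_lt_trans t1 _) (le_lt_trans t2 _).
  have {}g1 : `|f p.1 p.2 - f q.1 q.2| < e / 2 by apply: g1; lra.
  have {}g2 : `|f p.1 p.2 - f p'.1 p'.2| < e / 2 by apply: g2; lra.
  have := ler_distD (f p.1 p.2) (f p'.1 p'.2) (f q.1 q.2).
  by rewrite (distrC (f p'.1 p'.2) (f p.1 p.2)); lra.
move=> /(filterI (nbhs_right_gt 0)) /filter_ex[del [del0 H]].
by exists del => // x x' y y' ix ix' iy iy' h1 h2; apply: (H (x, y) _ (x', y')).
Qed.

Lemma sum_bernS_le1 (R : realType) N (u : R) : 0 <= u <= 1 ->
  \sum_(k < N) bern N k.+1 u <= 1 /\ \sum_(k < N.+1) bern N k.+1 u <= 1.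
Proof.
move=> u01; have h := sum_bern N u.
have h1 : \sum_(k < N) bern N k.+1 u <= 1.
  by rewrite -[leRHS]h big_ord_recl/= lerDr bern_ge0.
by split => //; rewrite big_ord_recr/= bern_small// addr0.
Qed.

(** The differences of consecutive x-weights have total absolute mass at most 2 and the y-weights at
    most 1; the prefactor N remains. *)
Lemma bernstein_kernel_stable (R : realType) (B B' : R -> R -> R) M (x y e : R) :
  0 <= x <= 1 -> 0 <= y <= 1 ->
  (forall u v, in01 u -> in01 v -> `|B u v - B' u v| <= e) ->
  `|bernstein_kernel M.+1 B x y - bernstein_kernel M.+1 B' x y| <= 2 * M.+1%:R * e.
Proof.
move=> x01 y01 BB; set N := M.+1.
have N0 : 0 < N%:R :> R by rewrite ltr0n.
have fN k : (k <= N)%N -> in01 (k%:R / N%:R : R).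
  by move=> kN; rewrite /in01 in_itv/= divr_ge0//= ler_pdivrMr// mul1r ler_nat.
have e0 : 0 <= e by apply: le_trans (BB _ _ (fN 0%N (leq0n _)) (fN 0%N (leq0n _))).
rewrite /bernstein_kernel -mulrBr normrM ger0_norm; last exact: ltW.
rewrite [2 * _]mulrC -mulrA ler_wpM2l ?(ltW N0)// -sumrB big_add1/= big_mkord.
apply: (@le_trans _ _ (\sum_(i < N) \sum_(j < N)
    e * ((bern M i x + bern M i.+1 x) * bern N j.+1 y))).
  apply: (le_trans (ler_norm_sum _ _ _)); apply: ler_sum => i _.
  rewrite -sumrB big_add1/= big_mkord.
  apply: (le_trans (ler_norm_sum _ _ _)); apply: ler_sum => j _.
  rewrite -mulrBl -mulrBl !normrM -mulrA (ger0_norm (bern_ge0 _ _ y01)).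
  apply: ler_pM; rewrite ?mulr_ge0 ?bern_ge0//; first by apply: BB; exact: fN.
  rewrite ler_wpM2r ?bern_ge0// (le_trans (ler_normB _ _))//.
  by rewrite !ger0_norm ?bern_ge0.
under eq_bigr do rewrite -mulr_sumr -mulr_sumr.
rewrite -mulr_sumr -mulr_suml big_split/= sum_bern mulrC ler_wpM2r//.
have [_ h1] := sum_bernS_le1 M x01; have [h2 _] := sum_bernS_le1 N y01.
rewrite -[leRHS]mulr1; apply: ler_pM => //.
- by rewrite addr_ge0// sumr_ge0// => i _; rewrite bern_ge0.
- by rewrite sumr_ge0// => i _; rewrite bern_ge0.
- by lra.
Qed.

(** * Convergence of the Bernstein kernel of the copula *)

Section kernel.
Context {R : realType}.
Variables (A : R -> R -> R) (kA : R.-pker R ~> R).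
Hypothesis cA : is_copula A.
Hypothesis mA : markov_kernel_of A kA.
Local Notation f x y := (fine (kA x `[0, y]%classic)).

Lemma pker_le1 x B : measurable B -> (kA x B <= 1)%E.
Proof.
by move=> mB; rewrite -(@prob_kernel _ _ _ _ _ kA x); apply: le_measure; rewrite ?inE.
Qed.

Lemma pker_fineK x B : measurable B -> kA x B = (fine (kA x B))%:E.
Proof.
by move=> mB; rewrite fineK// ge0_fin_numE// (le_lt_trans (pker_le1 _ mB))// ltry.
Qed.

Lemma markov_kernel01 x y : 0 <= f x y <= 1.
Proof. by rewrite fine_ge0//= -lee_fin -pker_fineK// pker_le1. Qed.

(** The increment is the integral of the kernel over the half-open interval from u1 to u2, chosen so
    that [0, u2] splits disjointly. The condition 0 <= lo serves the comparison of nonnegative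
    integrals. *)
Lemma copula_increment_bounds u1 u2 v lo hi : in01 u1 -> in01 u2 -> in01 v ->
  u1 <= u2 -> 0 <= lo -> (forall t, u1 <= t <= u2 -> lo <= f t v <= hi) ->
  lo * (u2 - u1) <= A u2 v - A u1 v <= hi * (u2 - u1).
Proof.
move=> i1 i2 iv u12 lo0 H.
have [_ [mu [[_ muA] kmu]]] := mA.
have i01 (x : R) : in01 x -> 0 <= x <= 1 by rewrite /in01 in_itv.
have /andP[u10 u11] := i01 _ i1; have /andP[u20 u21] := i01 _ i2.
have /andP[v0 v1] := i01 _ iv.
pose I : set R := `]u1, u2]%classic.
pose V : set R := `[0, v]%classic.
have mI : measurable I by exact: measurable_itv.
have mV : measurable V by exact: measurable_itv.
have muI : mu (I `*` V) = (A u2 v - A u1 v)%:E.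
  pose J (a : R) : set R := `[0, a]%classic.
  have mJ a : measurable (J a) by exact: measurable_itv.
  have JU : J u2 `*` V = (J u1 `*` V) `|` (I `*` V).
    apply/seteqP; split => -[a b] /=; rewrite /J /I/= !in_itv/=.
      by move=> [/andP[a0 au] Vb]; rewrite a0 au andbT; case: (leP a u1); [left|right].
    move=> [[/andP[-> a1] Vb]|[/andP[a1 ->] Vb]]; first by rewrite (le_trans a1).
    by rewrite andbT (le_trans u10)// ltW.
  have : mu (J u2 `*` V) = (mu (J u1 `*` V) + mu (I `*` V))%E.
    rewrite JU measureU; [by []|exact: measurableX|exact: measurableX|].
    apply/seteqP; split => // -[a b] [[/= + _] [/= + _]].
    rewrite /J /I/= !in_itv/= => /andP[_ h] /andP[h1 _].
    by move: h1; rewrite ltNge h.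
  rewrite !muA// => h; apply/eqP; rewrite EFinB.
  by rewrite h addeAC subee// add0e.
have kI : (\int[@lebesgue_measure R]_(x in I) kA x V)%E = (A u2 v - A u1 v)%:E.
  rewrite -muI kmu// => x; rewrite /I/V/= !in_itv/= => /andP[h1 h2]; apply/andP; split.
  - exact: le_trans (ltW h1).
  - exact: le_trans u21.
  - by [].
  - exact: le_trans v1.
have cst (c : R) : (\int[@lebesgue_measure R]_(x in I) c%:E)%E = (c * (u2 - u1))%:E.
  rewrite integral_cst// /I/= lebesgue_measure_itv/= lte_fin.
  have [_|u21'] := ltP u1 u2; first by rewrite EFinM EFinB.
  have -> : u2 = u1 by apply/eqP; rewrite eq_le u12 u21'.
  by rewrite subrr mulr0 mule0.
have mk : measurable_fun I (kA ^~ V).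
  by apply: measurable_funTS; exact: measurable_kernel.
have HI t : I t -> lo <= f t v <= hi.
  by rewrite /I/= in_itv/= => /andP[a b]; apply: H; rewrite b ltW.
apply/andP; split.
  rewrite -lee_fin -cst -kI; apply: ge0_le_integral => //.
  by move=> t It; rewrite pker_fineK// lee_fin; have /andP[] := HI _ It.
rewrite -lee_fin -cst -kI; apply: ge0_le_integral => //.
by move=> t It; rewrite pker_fineK// lee_fin; have /andP[] := HI _ It.
Qed.

Lemma copula_increment_close u1 u2 v c e : in01 u1 -> in01 u2 -> in01 v ->
  u1 <= u2 -> 0 <= c -> (forall t, u1 <= t <= u2 -> `|f t v - c| <= e) ->
  `|A u2 v - A u1 v - c * (u2 - u1)| <= e * (u2 - u1).
Proof.
move=> i1 i2 iv u12 c0 H.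
(* c - e may be negative; truncating it at 0 is harmless because the kernel is nonnegative. *)
have /andP[h1 h2] : Num.max 0 (c - e) * (u2 - u1) <= A u2 v - A u1 v <= (c + e) * (u2 - u1).
  apply: copula_increment_bounds => //; first by rewrite le_max lexx.
  move=> t /H; rewrite ler_norml => /andP[a b].
  have /andP[f0 _] := markov_kernel01 t v; rewrite ge_max f0/=.
  by apply/andP; split; lra.
have h3 : (c - e) * (u2 - u1) <= Num.max 0 (c - e) * (u2 - u1).
  by rewrite ler_wpM2r ?subr_ge0// le_max lexx orbT.
by rewrite ler_norml; apply/andP; split; lra.
Qed.

(** Chebyshev's argument in the form of [modulus]: at distance at least [del] in some coordinate,
    the difference of kernel values, at most 1, is dominated by the squared distance over del^2.
    Averaging then needs only second moments. *)
Lemma bernstein_kernel_cvg : continuous_markov_kernel kA ->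
  forall e, 0 < e -> exists2 C, 0 < C & forall M u v, in01 u -> in01 v ->
    `|bernstein_kernel M.+1 A u v - f u v| <= e + C / M.+1%:R.
Proof.
move=> cf e e0.
have [del del0 /= Hdel] :=
  compact_uniform_continuity (f := fun x y => f x y) cf e0.
have i01 (x : R) : in01 x -> 0 <= x <= 1 by rewrite /in01 in_itv.
have modulus t t' y y' : in01 t -> in01 t' -> in01 y -> in01 y' ->
    `|f t y - f t' y'| <= e + ((t - t') ^+ 2 + (y - y') ^+ 2) / del ^+ 2.
  move=> it it' iy iy'.
  have sq (z : R) : 0 <= z ^+ 2 / del ^+ 2 by rewrite divr_ge0 ?sqr_ge0.
  have far (z : R) : ~~ (`|z| < del) -> 1 <= z ^+ 2 / del ^+ 2.
    rewrite -leNgt => zd; rewrite ler_pdivlMr ?exprn_gt0// mul1r.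
    by rewrite -[leRHS]real_normK ?num_real// lerXn2r ?nnegrE ?(ltW del0).
  have le1 : `|f t y - f t' y'| <= 1.
    have /andP[? ?] := markov_kernel01 t y; have /andP[? ?] := markov_kernel01 t' y'.
    by rewrite ler_norml; apply/andP; split; lra.
  have := sq (t - t'); have := sq (y - y'); rewrite mulrDl => s1 s2.
  have [h1|/far h1] := boolP (`|t - t'| < del); last by lra.
  have [h2|/far h2] := boolP (`|y - y'| < del); last by lra.
  by have := Hdel _ _ _ _ it it' iy iy' h1 h2; lra.
(* 2 (M/4) + 2 + N/4 <= 3N for N = M + 1, to be divided by N^2 del^2. *)
exists (3 / del ^+ 2); first by rewrite divr_gt0 ?exprn_gt0.
move=> M u v iu iv; set N := M.+1.
have N0 : 0 < N%:R :> R by rewrite ltr0n.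
have u01 := i01 _ iu; have v01 := i01 _ iv.
have fN k : (k <= N)%N -> in01 (k%:R / N%:R : R).
  by move=> kN; rewrite /in01 in_itv/= divr_ge0//= ler_pdivrMr// mul1r ler_nat.
rewrite bernstein_kernelE; last first.
  move=> z z01; have iz : in01 z by rewrite /in01 in_itv.
  by have [? [? _]] := cA.1 z iz.
rewrite -/N.
have fE : f u v = \sum_(i < N) \sum_(j < N.+1) bern M i u * bern N j v * f u v.
  under eq_bigr do rewrite -mulr_suml.
  by rewrite -mulr_suml sum_bern2 mul1r.
rewrite [X in _ - X]fE -sumrB {fE}.
(* The x-weights have degree M but the nodes are i/N. For t between i/N and (i+1)/N, N(t - u) is i -
   M u plus a remainder of absolute value at most 1, and (a + b)^2 <= 2a^2 + 2b^2. *)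
pose eta (i j : nat) : R := e +
  (2 * (i%:R - M%:R * u) ^+ 2 + 2 + (j%:R - N%:R * v) ^+ 2) / (N%:R ^+ 2 * del ^+ 2).
apply: (@le_trans _ _ (\sum_(i < N) \sum_(j < N.+1) eta i j * (bern M i u * bern N j v))).
  apply: (le_trans (ler_norm_sum _ _ _)); apply: ler_sum => i _.
  rewrite -sumrB.
  apply: (le_trans (ler_norm_sum _ _ _)); apply: ler_sum => j _.
  rewrite [_ * f u v]mulrC -mulrBl normrM.
  rewrite [X in _ * X <= _]ger0_norm ?mulr_ge0 ?bern_ge0//.
  rewrite ler_wpM2r ?mulr_ge0 ?bern_ge0//.
  have iN : (i <= N)%N by exact: ltnW.
  have jN : (j <= N)%N by rewrite -ltnS.
  have /andP[c0 _] := markov_kernel01 u v.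
  have dN : i.+1%:R / N%:R - i%:R / N%:R = N%:R^-1 :> R.
    by rewrite -natr1 mulrDl addrC addKr mul1r.
  have ii : i%:R / N%:R <= i.+1%:R / N%:R :> R.
    by rewrite ler_pM2r ?invr_gt0// ler_nat.
  have := @copula_increment_close (i%:R / N%:R) (i.+1%:R / N%:R) (j%:R / N%:R) (f u v) (eta i j)
    (fN i iN) (fN i.+1 (ltn_ord i)) (fN j jN) ii c0.
  rewrite dN; set Del := A _ _ - A _ _ => h.
  have -> : N%:R * Del - f u v = N%:R * (Del - f u v * N%:R^-1).
    by rewrite [RHS]mulrBr [_ * (f u v * _)]mulrCA mulfV ?mulr1 ?gt_eqF.
  rewrite normrM (gtr0_norm N0) mulrC -ler_pdivlMr//.
  apply: h => t /andP[t1 t2].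
  have it : in01 t.
    have /andP[? _] := i01 _ (fN i iN); have /andP[_ ?] := i01 _ (fN i.+1 (ltn_ord i)).
    by rewrite /in01 in_itv/=; apply/andP; split; [exact: le_trans t1|exact: le_trans t2 _].
  apply: (le_trans (modulus _ _ _ _ it iu (fN j jN) iv)).
  rewrite /eta lerD2l [in leRHS]invfM [leRHS]mulrA ler_wpM2r ?invr_ge0 ?exprn_ge0 ?(ltW del0)//.
  rewrite ler_pdivlMr ?exprn_gt0// mulrDl -!exprMn !mulrBl divfK ?gt_eqF//.
  rewrite [v * _]mulrC lerD2r.
  move: t1 t2; rewrite ler_pdivrMr// ler_pdivlMr// -natr1 => t1 t2.
  have -> : N%:R = M%:R + 1 :> R by rewrite natr1.
  rewrite -/N in t1 t2; have NE : N%:R = M%:R + 1 :> R by rewrite natr1.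
  rewrite NE in t1 t2.
  set a := i%:R - M%:R * u.
  have -> : t * (M%:R + 1) - u * (M%:R + 1) = a + (t * (M%:R + 1) - i%:R - u).
    by rewrite /a; ring.
  set b := t * (M%:R + 1) - i%:R - u.
  have /andP[u0 u1] := u01.
  have b1 : b ^+ 2 <= 1.
    by rewrite -[leLHS]real_normK ?num_real// expr_le1// ler_norml /b; apply/andP; split; lra.
  clearbody a b; have := sqr_ge0 (a - b).
  have -> : (a + b) ^+ 2 = 2 * a ^+ 2 + 2 * b ^+ 2 - (a - b) ^+ 2 by ring.
  lra.
pose K : R := (N%:R ^+ 2 * del ^+ 2)^-1.
have -> : \sum_(i < N) \sum_(j < N.+1) eta i j * (bern M i u * bern N j v) =
    e + K * (2 * \sum_(i < N) (i%:R - M%:R * u) ^+ 2 * bern M i u + 2 +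
      \sum_(j < N.+1) (j%:R - N%:R * v) ^+ 2 * bern N j v).
  set S := \sum_(j < N.+1) _ ^+ 2 * _.
  transitivity (\sum_(i < N) ((e + 2 * K + K * S) * bern M i u
      + 2 * K * ((i%:R - M%:R * u) ^+ 2 * bern M i u))); last first.
    by rewrite big_split/= -!mulr_sumr sum_bern; ring.
  apply: eq_bigr => i _.
  transitivity (\sum_(j < N.+1) ((e + K * (2 * (i%:R - M%:R * u) ^+ 2 + 2)) * bern M i u
      * bern N j v + K * bern M i u * ((j%:R - N%:R * v) ^+ 2 * bern N j v))).
    by apply: eq_bigr => j _; rewrite /eta /K; ring.
  by rewrite big_split/= -!mulr_sumr sum_bern -/S; ring.
rewrite lerD2l.
have h1 := sum_bern_sqr_le M u01; have h2 := sum_bern_sqr_le N v01.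
apply: (@le_trans _ _ (K * (3 * N%:R))).
  rewrite ler_wpM2l ?invr_ge0 ?mulr_ge0 ?exprn_ge0 ?(ltW del0)//.
  have NE : N%:R = M%:R + 1 :> R by rewrite natr1.
  have M0 : 0 <= M%:R :> R by [].
  by rewrite NE in h2 *; lra.
rewrite /K le_eqVlt; apply/orP; left; apply/eqP.
by field; rewrite !gt_eqF.
Qed.

End kernel.

(** * Assembling the estimates *)

Lemma ereal_cvg0 (R : realType) (u : nat -> \bar R) :
  (forall e : R, 0 < e -> \forall n \near \oo, (0 <= u n <= e%:E)%E) ->
  u @ \oo --> 0%E.
Proof.
move=> H; apply/fine_cvgP; split.
  apply: filterS (H 1 ltr01) => n /andP[u0 u1].
  by rewrite ge0_fin_numE// (le_lt_trans u1)// ltry.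
apply/cvgrPdist_le => e e0; apply: filterS (H e e0) => n /andP[u0 u1] /=.
have uf : u n \is a fin_num by rewrite ge0_fin_numE// (le_lt_trans u1)// ltry.
by rewrite sub0r normrN ger0_norm ?fine_ge0// -lee_fin fineK.
Qed.

Lemma near_powRN_lt (R : realType) (a c : R) : 0 < a -> 0 < c ->
  \forall n \near \oo, (n%:R : R) `^ (- a) < c.
Proof.
move=> a0 c0; have := nbhs_infty_gtr (c^-1 `^ a^-1).
apply: filterS => n nm.
have m0 : 0 <= c^-1 `^ a^-1 by exact: powR_ge0.
have n0 : 0 < n%:R :> R by exact: le_lt_trans nm.
have := @gt0_ltr_powR R a a0 (c^-1 `^ a^-1) n%:R.
rewrite !nnegrE m0 (ltW n0) => /(_ isT isT nm).
rewrite -powRrM mulVf ?gt_eqF// powRr1 ?invr_ge0 ?ltW// => h.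
by rewrite powRN -[ltRHS]invrK ltf_pV2// posrE ?powR_gt0 ?invr_gt0.
Qed.

Theorem theorem4p3 (R : realType) (d : measure_display) (T : measurableType d)
  (P : probability T R) (X Y : nat -> T -> R) (A : R -> R -> R)
  (kA : R.-pker R ~> R) (s : R) :
  (forall i, measurable_fun setT (X i)) ->
  (forall i, measurable_fun setT (Y i)) ->
  iid P (fun i w => (X i w, Y i w)) ->
  continuous (fun xy : (R * R)%type => joint_distr_fun P (X 0%N) (Y 0%N) xy.1 xy.2) ->
  is_copula A ->
  (forall x y, joint_distr_fun P (X 0%N) (Y 0%N) x y =
               A (distr_fun P (X 0%N) x) (distr_fun P (Y 0%N) y)) ->
  markov_kernel_of A kA ->
  continuous_markov_kernel kA ->
  0 < s < 1 / 2 ->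
  {ae P, forall w,
    (fun n : nat => ereal_sup (range (fun xy : (R * R)%type =>
       (`| bernstein_kernel (Nn s n) (emp_copula X Y n w)
              (emp_df X n w xy.1) (emp_df Y n w xy.2)
           - K_H kA (distr_fun P (X 0%N)) (distr_fun P (Y 0%N)) xy.1 xy.2 |)%:E)))
    @ \oo --> 0%E}.
Proof.
move=> mX mY iidXY cH cA HA mA cK /andP[s0 s1].
set F := distr_fun P (X 0%N); set G := distr_fun P (Y 0%N).
(* Midpoint of s and 1/2. *)
pose r := (s + 1 / 2) / 2.
have r01 : 0 < r < 1 / 2 by rewrite /r; apply/andP; split; lra.
have rs : 0 < r - s by rewrite /r; lra.
have cF : continuous F by exact: joint_continuous_left mX mY cH.
have cG : continuous G by exact: joint_continuous_right mX mY cH.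
have F01 := distr_fun01 P (mX 0%N); have G01 := distr_fun01 P (mY 0%N).
have Fd := distr_fun_dense (mX 0%N) cF; have Gd := distr_fun_dense (mY 0%N) cG.
apply: filterS (empirical_df_rate mX mY cH iidXY r01) => w rate.
apply: ereal_cvg0 => e e0; have e4 : 0 < e / 4 by lra.
have [C C0 HC] := bernstein_kernel_cvg cA mA cK e4.
have [del del0 Hdel] :=
  compact_uniform_continuity (f := fun x y => fine (kA x `[0, y]%classic)) cK e4.
(* Thresholds for, in turn, 54 n^(s-r) <= e/4, 3 n^(-r) < del, and C/N <= 2C n^(-s) <= e/4. With e/4
   from the kernel convergence and e/4 from changing its arguments, the total is e. *)
have c1 : 0 < e / 216 by lra.
have c2 : 0 < del / 3 by lra.
have c3 : 0 < e / (8 * C) by rewrite divr_gt0// mulr_gt0.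
have r0 : 0 < r by case/andP: r01.
apply: filterS (filterI (filterI rate (near_powRN_lt rs c1)) (filterI (filterI
  (near_powRN_lt r0 c2) (near_powRN_lt s0 c3)) (nbhs_infty_gt 0))).
move=> n [[[FD GD HD] n1] [[n2 n3] /= n0]].
have n0' : 0 < n%:R :> R by rewrite ltr0n.
have n1' : 1 <= n%:R :> R by rewrite ler1n.
have ns0 : 0 < n%:R `^ s :> R by rewrite powR_gt0.
have Nle : (Nn s n)%:R <= n%:R `^ s :> R by rewrite truncn_le// ltW.
have N0 : (0 < Nn s n)%N.
  by rewrite truncn_gt0 -[leLHS](powRr0 n%:R) ler_powR// ltW.
set D := 3 * n%:R `^ (- r) in FD GD HD.
have D0 : 0 < D by rewrite mulr_gt0// powR_gt0.
have Dn : n%:R^-1 <= D.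
  have : n%:R^-1 <= n%:R `^ (- r) :> R.
    rewrite powRN lef_pV2 ?posrE ?powR_gt0//.
    by apply: ler1_powR => //; rewrite /r; lra.
  by have := powR_ge0 (n%:R : R) (- r); rewrite /D; lra.
have Edev := emp_copula_dev n0 cA HA F01 G01 Fd Gd D0 Dn FD GD HD.
apply/andP; split.
  (* Nonnegativity of the supremum needs a point of the family; the origin serves. *)
  apply: (@le_trans _ _ (`|bernstein_kernel (Nn s n) (emp_copula X Y n w)
      (emp_df X n w 0) (emp_df Y n w 0) - K_H kA F G 0 0|)%:E).
    by rewrite lee_fin.
  by apply: ereal_sup_ubound; exists (0, 0).
apply: ge_ereal_sup => _ [[x y] _ <-] /=; rewrite lee_fin /K_H.
have emp01 (V : nat -> T -> R) t : in01 (emp_df V n w t).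
  by rewrite emp_df_grid; apply: grid01 => //; rewrite -[leqRHS](card_ord n) max_card.
have i01 (z : R) : in01 z -> 0 <= z <= 1 by rewrite /in01 in_itv.
have iF : in01 (F x) by rewrite /in01 in_itv; exact: F01.
have iG : in01 (G y) by rewrite /in01 in_itv; exact: G01.
move: (emp01 X x) (emp01 Y y) (FD x) (GD y).
move: (emp_df X n w x) (emp_df Y n w y) => u v iu iv uF vG.
have h1 := bernstein_kernel_stable (Nn s n).-1 (i01 _ iu) (i01 _ iv) Edev.
have h2 := HC (Nn s n).-1 u v iu iv.
rewrite !prednK// in h1 h2.
have Dd : D < del by rewrite /D; lra.
have h3 := Hdel _ _ _ _ iu iF iv iG (le_lt_trans uF Dd) (le_lt_trans vG Dd).
have k1 : 2 * (Nn s n)%:R * (9 * D) <= e / 4.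
  have : (Nn s n)%:R * n%:R `^ (- r) <= n%:R `^ (- (r - s)) :> R.
    have -> : - (r - s) = s + (- r) by ring.
    rewrite powRD; last by rewrite (gt_eqF n0') implybT.
    by rewrite ler_wpM2r// powR_ge0.
  by rewrite /D; lra.
have k2 : C / (Nn s n)%:R <= e / 4.
  (* n^s < N + 1 <= 2N, since N >= 1. *)
  have Ngt : n%:R `^ s < 2 * (Nn s n)%:R :> R.
    have /andP[_ h] := truncn_itv (ltW ns0); apply: (lt_le_trans h).
    by rewrite -natrM ler_nat mul2n -addnn -addn1 leq_add2l.
  move: n3; rewrite powRN ltr_pdivlMr ?mulr_gt0// mulrC ltr_pdivrMr// => n3.
  rewrite ler_pdivrMr ?ltr0n//.
  have : e * n%:R `^ s <= e * (2 * (Nn s n)%:R) by rewrite ler_wpM2l// ltW.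
  by lra.
move: h3 h1 h2.
set a := bernstein_kernel _ (emp_copula _ _ _ _) _ _; set b := bernstein_kernel _ _ _ _.
set c := fine _; set c' := fine _ => h3 h1 h2.
have := ler_distD b a c'; have := ler_distD c b c'; lra.
Qed.
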